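(* Let $\omega\in P^+$ be minuscule or quasi-minuscule. Then for all $\lambda\in P_c$ and all $\xi\in\mathcal{P}_c(0)$, $$\chi_\omega(\xi)\chi_\lambda(\xi)=(N_{0,\omega}-N_{\lambda,\omega})\,\chi_\lambda(\xi)+\sum_{\substack{\nu\in W_0\omega\\ \lambda+\nu\in P_c}}\chi_{\lambda+\nu}(\xi),$$ where $N_{\lambda,\omega}=|\{a_j\mid 0\le j\le n,\ a_j(\lambda)=0\text{ and }\alpha_j\in W_0\omega\}|$ (so $N_{\lambda,\omega}=0$ if $\omega$ is minuscule).
   Context: $V$ is a real finite-dimensional Euclidean vector space with inner product $\langle\cdot,\cdot\rangle$, spanned by an irreducible reduced crystallographic root system $R_0$ of rank $n$, with weight lattice $P$, Weyl group $W_0$ (with length function $\ell$), a fixed choice of positive roots $R_0^+$ with simple roots $\alpha_1,\dots,\alpha_n$, and the corresponding cone of dominant weights $P^+$. For $x\in V\setminus\{0\}$ put $x^\vee:=2x/\langle x,x\rangle$, and $R_0^\vee=\{\alpha^\vee\mid\alpha\in R_0\}$. Let $\varphi$ and $\vartheta$ be the highest root and the highest short root of $R_0^+$ (equal if $R_0$ is simply-laced), and $u_\varphi=2/\langle\varphi,\varphi\rangle$. Fix an admissible pair $(R_0,\hat R_0)$: $\hat R_0$ is either $R_0^\vee$ or $u_\varphi R_0$. For $\alpha\in R_0$ let $\hat\alpha:=\alpha^\vee$ if $\hat R_0=R_0^\vee$, and $\hat\alpha:=u_\varphi\alpha$ if $\hat R_0=u_\varphi R_0$; $\hat R_0^+=\{\hat\alpha\mid\alpha\in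 R_0^+\}$; $\hat P$ is the weight lattice of $\hat R_0$; $\alpha_0=-\vartheta$ if $\hat R_0=R_0^\vee$ and $\alpha_0=-\varphi$ if $\hat R_0=u_\varphi R_0$. Fix an integer $c>1$. The affine simple roots are the affine functions on $V$ given by $a_0(x)=\langle x,\alpha_0^\vee\rangle+c$ and $a_j(x)=\langle x,\alpha_j^\vee\rangle$ $(1\le j\le n)$. $P_c=\{\lambda\in P\mid 0\le\langle\lambda,\beta\rangle\le c\ \forall\beta\in\hat R_0^+\}$ and $\hat P_c=\{\mu\in\hat P\mid 0\le\langle\mu,\alpha\rangle\le c\ \forall\alpha\in R_0^+\}$. With $\rho=\frac12\sum_{\alpha\in R_0^+}\alpha$, $\hat\rho=\frac12\sum_{\beta\in\hat R_0^+}\beta$ and $h=1-\langle\rho,\alpha_0^\vee\rangle$, put $\mathcal{P}_c(0)=\{\frac{2\pi}{h+c}(\hat\rho+\mu)\mid\mu\in\hat P_c\}$. For $\lambda\in P^+$ the Weyl character is $\chi_\lambda(\xi)=\delta(\xi)^{-1}\sum_{w\in W_0}(-1)^{\ell(w)}e^{i\langle w\xi,\lambda+\rho\rangle}$ with $\delta(\xi)=\sum_{w\in W_0}(-1)^{\ell(w)}e^{i\langle w\xi,\rho\rangle}=\prod_{\alpha\in R_0^+}(e^{i\langle\xi,\alpha\rangle/2}-e^{-i\langle\xi,\alpha\rangle/2})$. A weight $\mu\in P$ is minuscule if $0\le\langle\mu,\alpha^\vee\rangle\le1$ for all $\alpha\in R_0^+$, and quasi-minuscule if $0\le\langle\mu,\alpha^\vee\rangle\le2$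 for all $\alpha\in R_0^+$ with the upper bound $2$ realized exactly once (the quasi-minuscule weight is unique and equals $\vartheta$). *)

(* Defs.v *)
From HB Require Import structures.
From mathcomp Require Import all_boot all_order all_algebra finmap.
From mathcomp Require Import sesquilinear.
From mathcomp Require Import all_classical all_reals all_analysis.
From mathcomp Require Import complex.
Set Implicit Arguments.
Unset Strict Implicit.
Unset Printing Implicit Defensive.
Import Order.TTheory GRing.Theory Num.Theory.

Local Open Scope classical_set_scope.
Local Open Scope ring_scope.

Definition expi (R : realType) (t : R) : R[i] := Complex (cos t) (sin t).

(* The two kinds of admissible pairs: the second member is the dual system
   [Dual] or the rescaling of the first by 2 / <phi, phi> [Rescaled]. *)
Variant pair_kind := Dual | Rescaled.

Section RootSystems.
Context (R : realType) (V : vectType R) (dot : {dot V for (@idfun R)}).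

Definition coroot (x : V) : V := (2 / dot x x) *: x.

Definition reflection (a x : V) : V := x - dot x (coroot a) *: a.

Definition root_system (R0 : {fset V}) : Prop :=
  [/\ 0 \notin R0,
      <<R0>>%VS = fullv,
      forall a b, a \in R0 -> b \in R0 -> reflection a b \in R0
    & forall a b, a \in R0 -> b \in R0 -> dot b (coroot a) \is a Num.int].

Definition reduced (R0 : {fset V}) : Prop :=
  forall (a : V) (k : R), a \in R0 -> k *: a \in R0 -> k = 1 \/ k = -1.

Definition irreducible_roots (R0 : {fset V}) : Prop :=
  R0 != fset0 /\
  forall S : {fset V}, (S `<=` R0)%fset ->
    (forall a b, a \in S -> b \in (R0 `\` S)%fset -> dot a b = 0) ->
    S = fset0 \/ S = R0.

Definition weight_lattice (S : {fset V}) : set V :=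
  [set x | forall a, a \in S -> dot x (coroot a) \is a Num.int].

Definition refl_prod (s : seq V) : V -> V :=
  foldr (fun a f => reflection a \o f) id s.

Definition weyl_group (R0 : {fset V}) : set (V -> V) :=
  [set w | exists2 s : seq V, {subset s <= R0} & w = refl_prod s].

Definition weyl_orbit (R0 : {fset V}) (x : V) : set V :=
  [set w x | w in weyl_group R0].

Section Base.
Context (n : nat) (alpha : n.-tuple V).

Definition pos_cone (x : V) : bool :=
  [forall i : 'I_n, coord alpha i x \is a Num.nat].

Definition simple_roots (R0 : {fset V}) : Prop :=
  [/\ basis_of fullv alpha, {subset alpha <= R0}
    & forall a, a \in R0 -> pos_cone a \/ pos_cone (- a)].

Definition pos_roots (R0 : {fset V}) : {fset V} :=
  [fset a in R0 | pos_cone a]%fset.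

Definition half_sum (S : {fset V}) : V := 2^-1 *: \sum_(a <- S) a.

Definition is_length (w : V -> V) (k : nat) : Prop :=
  (exists s : seq V, [/\ {subset s <= alpha}, w = refl_prod s & size s = k]) /\
  forall s : seq V, {subset s <= alpha} -> w = refl_prod s -> (k <= size s)%N.

Definition weyl_length (w : V -> V) : nat := xget 0%N [set k | is_length w k].

(* For S = R0 this is the highest root; for S the set of short roots it is the
   highest short root. *)
Definition is_highest (S : set V) (x : V) : Prop :=
  S x /\ forall b, S b -> pos_cone (x - b).

Definition highest_root (R0 : {fset V}) (phi : V) : Prop :=
  is_highest [set a | a \in R0] phi.

(* In the simply-laced case every root is short. *)
Definition short_roots (R0 : {fset V}) : set V :=
  [set a | a \in R0 /\ forall b, b \in R0 -> dot a a <= dot b b].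

Definition highest_short_root (R0 : {fset V}) (theta : V) : Prop :=
  is_highest (short_roots R0) theta.

Definition dominant_weights (R0 : {fset V}) : set V :=
  [set x | weight_lattice R0 x /\
           forall a, a \in pos_roots R0 -> 0 <= dot x (coroot a)].

Definition minuscule (R0 : {fset V}) (mu : V) : Prop :=
  weight_lattice R0 mu /\
  forall a, a \in pos_roots R0 -> 0 <= dot mu (coroot a) <= 1.

Definition quasi_minuscule (R0 : {fset V}) (mu : V) : Prop :=
  [/\ weight_lattice R0 mu,
      forall a, a \in pos_roots R0 -> 0 <= dot mu (coroot a) <= 2
    & #|` [fset a in pos_roots R0 | dot mu (coroot a) == 2]%fset| = 1%N].

Definition alternant (R0 : {fset V}) (x xi : V) : R[i] :=
  \sum_(w \in weyl_group R0) (-1) ^+ weyl_length w * expi (dot (w xi) x).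

Definition rho (R0 : {fset V}) : V := half_sum (pos_roots R0).

Definition weyl_denominator (R0 : {fset V}) (xi : V) : R[i] :=
  alternant R0 (rho R0) xi.

Definition weyl_character (R0 : {fset V}) (lam xi : V) : R[i] :=
  (weyl_denominator R0 xi)^-1 * alternant R0 (lam + rho R0) xi.

Section AdmissiblePair.
Context (R0 : {fset V}) (phi theta : V) (t : pair_kind) (c : nat).

Definition hat (a : V) : V :=
  match t with Dual => coroot a | Rescaled => (2 / dot phi phi) *: a end.

Definition hat_roots : {fset V} := [fset hat a | a in R0]%fset.
Definition hat_pos_roots : {fset V} := [fset hat a | a in pos_roots R0]%fset.

Definition alpha0 : V := match t with Dual => - theta | Rescaled => - phi end.

Definition affine_gradient (j : 'I_n.+1) : V :=
  if unlift ord0 j is Some i then tnth alpha i else alpha0.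

Definition affine_root (j : 'I_n.+1) : V -> R :=
  fun x => dot x (coroot (affine_gradient j)) + (if j == ord0 then c%:R else 0).

Definition alcove_weights : set V :=
  [set lam | weight_lattice R0 lam /\
     forall b, b \in hat_pos_roots -> 0 <= dot lam b <= c%:R].

Definition hat_alcove_weights : set V :=
  [set mu | weight_lattice hat_roots mu /\
     forall a, a \in pos_roots R0 -> 0 <= dot mu a <= c%:R].

Definition hat_rho : V := half_sum hat_pos_roots.

Definition height_const : R := 1 - dot (rho R0) (coroot alpha0).

Definition spectrum0 : set V :=
  [set (2 * pi / (height_const + c%:R)) *: (hat_rho + mu)
     | mu in hat_alcove_weights].

(* N_{lam, om}, counted as a set of affine functions. *)
Definition wall_count (lam om : V) : nat :=
  #|` fset_set [set affine_root j | j in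
        [set j : 'I_n.+1 | affine_root j lam = 0 /\
                           weyl_orbit R0 om (affine_gradient j)]] |.

End AdmissiblePair.
End Base.
End RootSystems.

(* Main.v *)
Require Import Defs.
From HB Require Import structures.
From mathcomp Require Import all_boot all_order all_algebra finmap.
From mathcomp Require Import sesquilinear.
From mathcomp Require Import all_classical all_reals all_analysis.
From mathcomp Require Import complex.
From mathcomp Require Import ring lra zify.
Set Implicit Arguments.
Unset Strict Implicit.
Unset Printing Implicit Defensive.
Import Order.TTheory GRing.Theory Num.Theory.
Local Open Scope classical_set_scope.
Local Open Scope ring_scope.

(** Write [J x] for the alternant at [xi] and [m] for the exponential sum over
    the orbit of [omega].  Weyl invariance of [m] gives
    [m * J (lam + rho) = \sum_nu J (lam + nu + rho)], [nu] in the orbit.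
    For [xi] in the spectrum, [x |-> J (x + rho)] is antisymmetric under the
    reflections in the shifted walls [a_j = -1], [0 <= j <= n].  As
    [<nu, beta^vee> >= -2] for each root [beta], with equality only if
    [nu = - beta], a weight [lam + nu] outside the alcove either lies on such a
    wall, so that its term vanishes, or is [lam - alpha_j] with [a_j lam = 0],
    and its term is [- J (lam + rho)].  Hence
    [m * J (lam + rho) = \sum_(lam + nu in P_c) J (lam + nu + rho)
       - N_(lam, omega) * J (lam + rho)].
    At [lam = 0] this reads [m = chi_omega - N_(0, omega)], since [omega] is the
    only dominant weight of its orbit.  If the Weyl denominator vanishes at [xi],
    then all characters are [0] by the convention [0^-1 = 0]. *)

(** * Coroots and reflections in a Euclidean space *)

Section Reflections.
Context (R : realType) (V : vectType R) (dot : {dot V for (@idfun R)}).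

Local Notation s := (reflection dot).
Local Notation "x ^v" := (coroot dot x) (at level 2, format "x ^v").

Lemma dotC x y : dot x y = dot y x.
Proof. by have := hermC dot x y; rewrite expr0 mul1r. Qed.

Lemma dotDr x y z : dot x (y + z) = dot x y + dot x z.
Proof. exact: linearDr. Qed.
Lemma dotNr x y : dot x (- y) = - dot x y.
Proof. exact: linearNr. Qed.
Lemma dotZr k x y : dot x (k *: y) = k * dot x y.
Proof. exact: linearZr_LR. Qed.
Lemma dotDl x y z : dot (y + z) x = dot y x + dot z x.
Proof. exact: linearDl. Qed.
Lemma dotNl x y : dot (- y) x = - dot y x.
Proof. exact: linearNl. Qed.
Lemma dotZl k x y : dot (k *: y) x = k * dot y x.
Proof. exact: linearZl_LR. Qed.
Lemma dot0r x : dot x 0 = 0.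
Proof. exact: linear0r. Qed.
Lemma dot0l x : dot 0 x = 0.
Proof. exact: linear0l. Qed.
Lemma dot_sumr (I : Type) (r : seq I) (P : pred I) (F : I -> V) x :
  dot x (\sum_(i <- r | P i) F i) = \sum_(i <- r | P i) dot x (F i).
Proof. exact: linear_sumr. Qed.

Definition dotE := (dotDl, dotDr, dotNl, dotNr, dotZl, dotZr).

Lemma dot_eq0 x : (dot x x == 0) = (x == 0).
Proof.
have [->|x0] := eqVneq x 0; first by rewrite dot0l eqxx.
by apply/negbTE; rewrite gt_eqF ?neq0_dnorm_gt0.
Qed.

Lemma dot_gt0 x : (0 < dot x x) = (x != 0).
Proof.
have [->|x0] := eqVneq x 0; first by rewrite dot0l ltxx.
exact: neq0_dnorm_gt0.
Qed.

Lemma dot_full0 x (B : seq V) : <<B>>%VS = fullv ->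
  (forall b, b \in B -> dot x b = 0) -> x = 0.
Proof.
move=> fullB x0; apply/eqP; rewrite -dot_eq0.
have : x \in <<B>>%VS by rewrite fullB memvf.
rewrite -[B]in_tupleE => /coord_span {2}->.
rewrite dot_sumr big1 // => i _.
by rewrite dotZr x0 ?mulr0 // mem_nth.
Qed.

Lemma coroot0 : 0^v = 0. Proof. by rewrite /coroot scaler0. Qed.

Lemma corootN x : (- x)^v = - x^v.
Proof. by rewrite /coroot !dotE opprK scalerN. Qed.

Lemma corootZ k x : (k *: x)^v = k^-1 *: x^v.
Proof.
have [->|k0] := eqVneq k 0; first by rewrite invr0 !scale0r coroot0.
rewrite /coroot !dotE !scalerA !invfM; congr (_ *: _).
by move: (dot x x)^-1 => d; field.
Qed.

Lemma dot_coroot x a : dot x a^v = 2 / dot a a * dot x a.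
Proof. by rewrite dotZr. Qed.

Lemma dot_coroot_self a : a != 0 -> dot a a^v = 2.
Proof. by rewrite -dot_eq0 dot_coroot => a0; rewrite divfK. Qed.

Lemma dot_coroot_ge0 x a : (0 <= dot x a^v) = (0 <= dot x a).
Proof.
have [->|a0] := eqVneq a 0; first by rewrite coroot0.
by rewrite dot_coroot pmulr_rge0 // divr_gt0 // dot_gt0.
Qed.

Lemma dot_coroot_eq0 x a : (dot x a^v == 0) = (dot x a == 0).
Proof.
have [->|a0] := eqVneq a 0; first by rewrite coroot0.
by rewrite dot_coroot mulf_eq0 gt_eqF // divr_gt0 // dot_gt0.
Qed.

Lemma corootK : involutive (coroot dot).
Proof.
move=> a; have [->|a0] := eqVneq a 0; first by rewrite !coroot0.
have := dot_gt0 a; rewrite a0 => ? ; rewrite {1}/coroot dot_coroot dotZl.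
by rewrite scalerA -[RHS]scale1r; congr (_ *: _); field; rewrite gt_eqF.
Qed.

Lemma coroot_inj : injective (coroot dot).
Proof. exact: inv_inj corootK. Qed.

Lemma reflectionD a x y : s a (x + y) = s a x + s a y.
Proof. by rewrite /reflection dotDl scalerDl opprD addrACA. Qed.

Lemma reflectionZ a k x : s a (k *: x) = k *: s a x.
Proof. by rewrite /reflection dotZl scalerBr scalerA. Qed.

Lemma reflection_self a : s a a = - a.
Proof.
have [->|a0] := eqVneq a 0; first by rewrite /reflection dot0l scale0r subr0 oppr0.
rewrite /reflection dot_coroot_self // scaler_nat mulr2n.
by rewrite opprD addrA subrr add0r.
Qed.

Lemma dot_reflection a x y : dot (s a x) (s a y) = dot x y.
Proof.
have [->|a0] := eqVneq a 0.
  by rewrite /reflection !coroot0 !dot0r !scaler0 !subr0.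
have := dot_gt0 a; rewrite a0 => ? ; rewrite /reflection !dot_coroot !dotE (dotC a).
by field; rewrite gt_eqF.
Qed.

Lemma dot_reflection_coroot a x : dot (s a x) a^v = - dot x a^v.
Proof.
have [->|a0] := eqVneq a 0; first by rewrite coroot0 !dot0r oppr0.
rewrite /reflection !(dotDl, dotNl, dotZl) dot_coroot_self //; ring.
Qed.

Lemma reflectionK a : involutive (s a).
Proof.
by move=> x; rewrite {1}/reflection dot_reflection_coroot scaleNr opprK subrK.
Qed.

Lemma dot_reflectionC a x y : dot (s a x) y = dot x (s a y).
Proof. by rewrite -{1}[y](reflectionK a) dot_reflection. Qed.

Lemma coroot_reflection a x : (s a x)^v = s a x^v.
Proof. by rewrite /coroot dot_reflection reflectionZ. Qed.

Lemma refl_prodD w x y :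
  refl_prod dot w (x + y) = refl_prod dot w x + refl_prod dot w y.
Proof. by elim: w => //= a w IH; rewrite IH reflectionD. Qed.

Lemma refl_prodZ w k x : refl_prod dot w (k *: x) = k *: refl_prod dot w x.
Proof. by elim: w => //= a w IH; rewrite IH reflectionZ. Qed.

Lemma dot_refl_prod w x y : dot (refl_prod dot w x) (refl_prod dot w y) = dot x y.
Proof. by elim: w => //= a w IH; rewrite dot_reflection IH. Qed.

Lemma refl_prod_cat w1 w2 :
  refl_prod dot (w1 ++ w2) = refl_prod dot w1 \o refl_prod dot w2.
Proof. by apply: funext => x; elim: w1 => //= a w1 ->. Qed.

Lemma refl_prod_rcons w a :
  refl_prod dot (rcons w a) = refl_prod dot w \o reflection dot a.
Proof. by rewrite -cats1 refl_prod_cat. Qed.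

Lemma refl_prodK w : cancel (refl_prod dot w) (refl_prod dot (rev w)).
Proof.
by move=> x; elim: w => //= a w IH; rewrite rev_cons refl_prod_rcons /= reflectionK.
Qed.

Lemma refl_prodVK w : cancel (refl_prod dot (rev w)) (refl_prod dot w).
Proof. by move=> x; rewrite -{1}[w]revK refl_prodK. Qed.

(** * The Weyl group and its finiteness *)

Section WeylGroup.
Context (R0 : {fset V}) (rootR : root_system dot R0).

Local Notation W := (weyl_group dot R0).

Lemma root_neq0 a : a \in R0 -> a != 0.
Proof. by case: rootR => R00 _ _ _ aR; apply: contraNneq R00 => <-. Qed.

Lemma root_dot_gt0 a : a \in R0 -> 0 < dot a a.
Proof. by move=> /root_neq0; rewrite dot_gt0. Qed.

Lemma root_reflection a b : a \in R0 -> b \in R0 -> s a b \in R0.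
Proof. by case: rootR => _ _ + _ => /[apply]/[apply]. Qed.

Lemma root_int a b : a \in R0 -> b \in R0 -> dot b a^v \is a Num.int.
Proof. by case: rootR => _ _ _ + => /[apply]/[apply]. Qed.

Lemma root_opp a : a \in R0 -> - a \in R0.
Proof. by move=> aR; rewrite -reflection_self root_reflection. Qed.

Lemma weyl_id : W id.
Proof. by exists [::]. Qed.

Lemma weyl_refl a : a \in R0 -> W (s a).
Proof. by move=> aR; exists [:: a] => // x; rewrite inE => /eqP->. Qed.

Lemma weyl_comp u w : W u -> W w -> W (u \o w).
Proof.
move=> [su suR ->] [sw swR ->]; exists (su ++ sw); last by rewrite refl_prod_cat.
by move=> x; rewrite mem_cat => /orP[/suR|/swR].
Qed.

Lemma weyl_inv w : W w -> exists w', [/\ W w', cancel w w' & cancel w' w].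
Proof.
move=> [sw swR ->]; exists (refl_prod dot (rev sw)); split.
- by exists (rev sw) => // x; rewrite mem_rev => /swR.
- exact: refl_prodK.
- exact: refl_prodVK.
Qed.

Lemma weylD w x y : W w -> w (x + y) = w x + w y.
Proof. by move=> [sw _ ->]; exact: refl_prodD. Qed.

Lemma weylZ w k x : W w -> w (k *: x) = k *: w x.
Proof. by move=> [sw _ ->]; exact: refl_prodZ. Qed.

Lemma weylN w x : W w -> w (- x) = - w x.
Proof. by move=> Ww; rewrite -scaleN1r weylZ // scaleN1r. Qed.

Lemma weyl_dot w x y : W w -> dot (w x) (w y) = dot x y.
Proof. by move=> [sw _ ->]; exact: dot_refl_prod. Qed.

Lemma weyl_coroot w x : W w -> w x^v = (w x)^v.
Proof. by move=> Ww; rewrite /coroot weyl_dot // weylZ. Qed.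

Lemma weyl_reflection w a x : W w -> w (s a x) = s (w a) (w x).
Proof.
move=> Ww; rewrite /reflection -weyl_coroot // weyl_dot //.
by rewrite weylD // weylN // weylZ.
Qed.

Lemma weyl_root w a : W w -> a \in R0 -> w a \in R0.
Proof.
move=> [sw swR ->]; elim: sw swR => //= b sw IH swR aR.
apply: root_reflection; first by rewrite swR ?mem_head.
by apply: IH => // x xsw; rewrite swR // inE xsw orbT.
Qed.

Lemma weyl_weight w x : W w -> weight_lattice dot R0 x -> weight_lattice dot R0 (w x).
Proof.
move=> Ww Px a aR; have [w' [Ww' wK w'K]] := weyl_inv Ww.
by rewrite -[a]w'K -weyl_coroot // weyl_dot // Px // weyl_root.
Qed.

(** Pairing [u x - w x] with a root [b] compares [x] with the preimages of [b] under [u] and [w];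
    these coincide, and the roots span the space. *)
Lemma weyl_ext u w : W u -> W w -> (forall a, a \in R0 -> u a = w a) -> u = w.
Proof.
move=> Wu Ww uw; apply: funext => x; apply/eqP; rewrite -subr_eq0; apply/eqP.
have [u' [Wu' uK u'K]] := weyl_inv Wu; have [w' [Ww' wK w'K]] := weyl_inv Ww.
have [_ fullR _ _] := rootR; apply: (dot_full0 fullR) => b bR.
rewrite dotDl dotNl -{1}[b]u'K -{2}[b]w'K !weyl_dot //.
have -> : w' b = u' b; last by rewrite subrr.
by apply: (can_inj wK); rewrite w'K -uw ?u'K // weyl_root.
Qed.

Lemma finite_weyl : finite_set W.
Proof.
(* [g] recovers a Weyl element from the self-map of the roots that it induces; the default [id] only
   serves self-maps induced by no element. *)
pose g (f : {ffun R0 -> R0}) : V -> V :=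
  @xget (V -> V) id [set w : V -> V | W w /\ forall a : R0, w (val a) = val (f a)].
apply: (@sub_finite_set _ _ (g @` setT)); last exact/finite_image/finite_finset.
move=> w Ww.
pose f := [ffun a : R0 => FSetSub (weyl_root Ww (valP a))] : {ffun R0 -> R0}.
exists f => //; rewrite /g; case: xgetP => [u -> [Wu uf]|/(_ w)].
  apply: weyl_ext => // a aR.
  by have := uf (FSetSub aR); rewrite ffunE.
by case; split=> // a; rewrite ffunE.
Qed.

End WeylGroup.
End Reflections.

(** * Positive roots and simple reflections *)

Section Base.
Context (R : realType) (V : vectType R) (dot : {dot V for (@idfun R)}).
Context (R0 : {fset V}) (rootR : root_system dot R0) (redR : reduced R0).
Context (n : nat) (alpha : n.-tuple V) (simpleR : simple_roots alpha R0).

Local Notation s := (reflection dot).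
Local Notation "x ^v" := (coroot dot x) (at level 2, format "x ^v").
Local Notation W := (weyl_group dot R0).
Local Notation al := (tnth alpha).
Local Notation pos := (pos_cone alpha).
Local Notation Rpos := (pos_roots alpha R0).

Definition dominant (x : V) : Prop := forall i : 'I_n, 0 <= dot x (al i).

Lemma int_gt0_ge1 (x : R) : x \is a Num.int -> 0 < x -> 1 <= x.
Proof. by move=> /intrP[k ->]; rewrite ltr0z ler1z gtz0_ge1. Qed.

Lemma coord_simpleE x : x = \sum_i coord alpha i x *: al i.
Proof.
have [balpha _ _] := simpleR; rewrite {1}(coord_basis balpha (memvf x)).
by apply: eq_bigr => i _; rewrite -tnth_nth.
Qed.

Lemma coord_simple i j : coord alpha i (al j) = (i == j)%:R.
Proof.
have [/andP[_ falpha] _ _] := simpleR.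
by rewrite (tnth_nth 0) coord_free // eq_sym.
Qed.

Lemma simple_root j : al j \in R0.
Proof. by have [_ sR _] := simpleR; apply: sR; exact: mem_tnth. Qed.

Lemma simple_neq0 j : al j != 0.
Proof. exact: (root_neq0 rootR (simple_root j)). Qed.

Lemma simple_dot_gt0 j : 0 < dot (al j) (al j).
Proof. exact: (root_dot_gt0 rootR (simple_root j)). Qed.

Lemma pos_simple j : pos (al j).
Proof. by apply/forallP => i; rewrite coord_simple natr_nat. Qed.

Lemma pos_coord_ge0 a i : pos a -> 0 <= coord alpha i a.
Proof. by rewrite /pos_cone => /forallP/(_ i)/natr_ge0. Qed.

Lemma pos_neg_eq0 a : pos a -> pos (- a) -> a = 0.
Proof.
move=> pa pNa; rewrite [a]coord_simpleE big1 // => i _.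
suff -> : coord alpha i a = 0 by rewrite scale0r.
apply/eqP; rewrite eq_le pos_coord_ge0 // andbT.
by have := pos_coord_ge0 i pNa; rewrite linearN oppr_ge0.
Qed.

Lemma pos_rootN a : a \in R0 -> pos (- a) = ~~ pos a.
Proof.
move=> aR; apply/idP/idP => [pNa|].
  apply/negP => pa; have := root_neq0 rootR aR.
  by rewrite (pos_neg_eq0 pa pNa) eqxx.
by have [_ _ /(_ a aR)[->|]] := simpleR.
Qed.

Lemma mem_pos_roots a : (a \in Rpos) = (a \in R0) && pos a.
Proof. by rewrite !inE. Qed.

Lemma dot_dominant_ge0 x a :
  dominant x -> (forall i, 0 <= coord alpha i a) -> 0 <= dot x a.
Proof.
move=> domx a0; rewrite [a]coord_simpleE dot_sumr sumr_ge0 // => i _.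
by rewrite dotZr mulr_ge0.
Qed.

Lemma dot_dominant_pos x a : dominant x -> pos a -> 0 <= dot x a.
Proof.
by move=> domx pa; apply: dot_dominant_ge0 => // i; exact: pos_coord_ge0.
Qed.

(** By reducedness, a positive root other than [al j] has a positive coefficient at another simple
    root. The reflection leaves that coefficient alone, so the image cannot be negative. *)
Lemma pos_root_reflection a j :
  a \in R0 -> pos a -> a != al j -> pos (s (al j) a).
Proof.
move=> aR pa aj; have saR := root_reflection rootR (simple_root j) aR.
have [i /andP[ij ai]|ai] := pickP (fun i => (i != j) && (coord alpha i a != 0)).
  apply/negPn; rewrite -pos_rootN //; apply/negP => /pos_coord_ge0 => /(_ i).
  rewrite linearN linearB linearZ /= coord_simple (negbTE ij) mulr0 subr0.
  by rewrite oppr_ge0 leNgt lt0r ai pos_coord_ge0.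
have aE : a = coord alpha j a *: al j.
  rewrite {1}[a]coord_simpleE (bigD1 j) //= big1 ?addr0 // => i ij.
  by have := ai i; rewrite ij /= => /eqP ->; rewrite scale0r.
have := aR; rewrite aE => /(redR (simple_root j)) [] k1.
  by rewrite aE k1 scale1r eqxx in aj.
by have := pos_coord_ge0 j pa; rewrite k1 oppr_ge0 ler10.
Qed.

Lemma reflection_simple_pos_roots j a : a \in Rpos -> a != al j ->
  s (al j) a \in Rpos /\ s (al j) a != al j.
Proof.
rewrite !mem_pos_roots => /andP[aR pa] aj; split.
  by rewrite (root_reflection rootR (simple_root j)) ?pos_root_reflection.
apply: contraTneq pa => /(congr1 (s (al j))).
by rewrite reflectionK reflection_self => ->; rewrite pos_rootN ?pos_simple ?simple_root.
Qed.

Lemma big_pos_roots_reflection (T : Type) (idx : T) (op : Monoid.com_law idx)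
    (F : V -> T) j :
  \big[op/idx]_(a <- Rpos | a != al j) F (s (al j) a) =
  \big[op/idx]_(a <- Rpos | a != al j) F a.
Proof.
rewrite -[LHS]big_filter -[RHS]big_filter -(big_map (s (al j)) predT F).
apply: perm_big; apply: uniq_perm.
- by rewrite (map_inj_uniq (inv_inj (reflectionK _ _))) filter_uniq ?fset_uniq.
- by rewrite filter_uniq ?fset_uniq.
move=> b; apply/mapP/idP => [[a]|].
  rewrite mem_filter => /andP[aj /reflection_simple_pos_roots/(_ aj)[? ?]] ->.
  by rewrite mem_filter; apply/andP.
rewrite mem_filter => /andP[bj /reflection_simple_pos_roots/(_ bj)[? ?]].
by exists (s (al j) b); rewrite ?reflectionK // mem_filter; apply/andP.
Qed.

Lemma simple_mem_pos_roots j : al j \in Rpos.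
Proof. by rewrite mem_pos_roots simple_root pos_simple. Qed.

(** The reflection in [al j] permutes the other positive roots and negates [al j], so it lowers the
    sum by [2 * k (al j)] times [al j]. The weight [k] is general so as to cover both [rho] and
    [hat_rho]. *)
Lemma dot_sum_pos_roots (k : V -> R) j :
  (forall a, k (s (al j) a) = k a) ->
  dot (\sum_(a <- Rpos) k a *: a) (al j)^v = 2 * k (al j).
Proof.
move=> ks; set T := \sum_(a <- _) _.
have sT : s (al j) T = T - (2 * k (al j)) *: al j.
  have -> : s (al j) T = \sum_(a <- Rpos) k (s (al j) a) *: s (al j) a.
    rewrite (big_morph _ (reflectionD dot (al j)) (id1 := 0)).
      by apply: eq_bigr => a _; rewrite reflectionZ ks.
    by rewrite /reflection dot0l scale0r subr0.
  rewrite /T (bigD1_seq _ (simple_mem_pos_roots j)) ?fset_uniq //=.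
  rewrite (big_pos_roots_reflection _ (fun a => k a *: a)).
  rewrite [X in _ = X - _](bigD1_seq _ (simple_mem_pos_roots j)) ?fset_uniq //=.
  rewrite ks reflection_self addrAC; congr (_ + _).
  by rewrite -scalerBl scalerN -scaleNr; congr (_ *: _); ring.
move: sT; rewrite /reflection => /addrI/oppr_inj/eqP.
by rewrite -subr_eq0 -scalerBl scaler_eq0 subr_eq0 (negbTE (simple_neq0 j)) orbF => /eqP.
Qed.

Lemma dot_rho_simple j : dot (rho alpha R0) (al j)^v = 1.
Proof.
rewrite /rho /half_sum dotZl.
have -> : \sum_(a <- Rpos) a = \sum_(a <- Rpos) (fun=> 1) a *: a.
  by apply: eq_bigr => a _; rewrite scale1r.
by rewrite dot_sum_pos_roots // mulr1 mulVf.
Qed.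

Lemma dot_rho_simple_gt0 j : 0 < dot (rho alpha R0) (al j).
Proof.
rewrite lt0r -dot_coroot_ge0 -dot_coroot_eq0 dot_rho_simple.
by rewrite oner_eq0 ler01.
Qed.

Lemma dominant_rho : dominant (rho alpha R0).
Proof. by move=> j; rewrite ltW ?dot_rho_simple_gt0. Qed.

(** As [dot a a > 0], some simple root pairs positively with [a]; its reflection subtracts a
    positive integer multiple of that simple root. *)
Lemma root_height_descent a : a \in R0 -> pos a -> (forall j, a != al j) ->
  exists2 j, pos (s (al j) a) &
    \sum_i coord alpha i (s (al j) a) <= \sum_i coord alpha i a - 1.
Proof.
move=> aR pa aal.
have [j aj] : exists j, 0 < dot a (al j).
  apply: contrapT => /forallNP aj; have := root_dot_gt0 rootR aR.
  apply/negP; rewrite -leNgt {2}[a]coord_simpleE dot_sumr.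
  apply: sumr_le0 => i _; rewrite dotZr mulr_ge0_le0 ?pos_coord_ge0 //.
  by rewrite leNgt; apply/negP.
exists j; first exact: pos_root_reflection.
have -> : \sum_i coord alpha i (s (al j) a) =
    \sum_i coord alpha i a - dot a (al j)^v.
  rewrite -[dot a _]mulr1 -[X in _ * X](_ : \sum_i (i == j)%:R = 1).
    rewrite mulr_sumr -sumrB; apply: eq_bigr => i _.
    by rewrite /reflection linearB linearZ /= coord_simple.
  by rewrite (bigD1 j) //= eqxx big1 ?addr0 // => i /negbTE ->.
rewrite lerB // int_gt0_ge1 ?(root_int rootR (simple_root j) aR) //.
by rewrite lt0r dot_coroot_eq0 dot_coroot_ge0 (gt_eqF aj) (ltW aj).
Qed.

Lemma pos_root_induction (P : V -> Prop) :
  (forall j, P (al j)) -> (forall a j, a \in R0 -> P a -> P (s (al j) a)) ->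
  forall a, a \in R0 -> pos a -> P a.
Proof.
move=> Pal Ps a aR pa.
have ht_ge0 b : pos b -> 0 <= \sum_i coord alpha i b.
  by move=> pb; apply: sumr_ge0 => i _; exact: pos_coord_ge0.
(* Heights are real numbers here, so the induction runs on a natural upper bound. *)
have [m] : exists m : nat, \sum_i coord alpha i a <= m%:R.
  exists (Num.bound (\sum_i coord alpha i a)).
  by rewrite ltW // archi_boundP // ht_ge0.
elim: m a aR pa => [|m IH] a aR pa ham.
all: have [[j ->]|aal] := pselect (exists j, a = al j); first exact: Pal.
all: have [|j pa' h'] := root_height_descent aR pa.
- by move=> j; apply/eqP => ?; apply: aal; exists j.
- by have := ht_ge0 _ pa'; lra.
- by move=> j; apply/eqP => ?; apply: aal; exists j.
rewrite -[a](reflectionK dot (al j)).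
have a'R := root_reflection rootR (simple_root j) aR.
by apply: Ps => //; apply: IH => //; move: ham; rewrite -natr1; lra.
Qed.

Lemma root_induction (P : V -> Prop) :
  (forall j, P (al j)) -> (forall a j, a \in R0 -> P a -> P (s (al j) a)) ->
  forall a, a \in R0 -> P a.
Proof.
move=> Pal Ps a aR; have sN j b : s (al j) (- b) = - s (al j) b.
  by rewrite -scaleN1r reflectionZ scaleN1r.
(* Both signs are carried at once: [- al j] is the image of [al j] under its own reflection. *)
have Q b : b \in R0 -> pos b -> P b /\ P (- b).
  move: b; apply: pos_root_induction => [j|b j bR [Pb PNb]].
    by split=> //; rewrite -(reflection_self dot); apply: Ps => //; exact: simple_root.
  by split; rewrite -?sN; apply: Ps => //; exact: (root_opp rootR).
have [_ _ /(_ a aR)[pa|pNa]] := simpleR; first by case: (Q a).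
by have [|_] := Q (- a) _ pNa; rewrite ?opprK //; exact: (root_opp rootR).
Qed.

(** Conjugating a reflection by a simple one adds two letters to its word, so the length stays odd;
    this parity gives a reflection its sign. *)
Lemma reflection_simple_word a : a \in R0 ->
  exists w, [/\ {subset w <= alpha}, s a = refl_prod dot w & odd (size w)].
Proof.
move: a; apply: root_induction => [j|a j aR [w [wal saE ow]]].
  by exists [:: al j]; split=> // x; rewrite inE => /eqP->; exact: mem_tnth.
exists (al j :: rcons w (al j)); split.
- move=> x; rewrite inE mem_rcons inE => /or3P[/eqP->|/eqP->|/wal//];
  exact: mem_tnth.
- apply: funext => x; rewrite /= refl_prod_rcons /= -saE.
  rewrite (weyl_reflection _ _ (weyl_refl dot (simple_root j))).
  by rewrite reflectionK.
- by rewrite /= size_rcons /= negbK.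
Qed.

Lemma weyl_simple_word w : W w ->
  exists2 u, {subset u <= alpha} & w = refl_prod dot u.
Proof.
move=> [sw swR ->]; elim: sw swR => [|a sw IH] swR; first by exists [::].
rewrite /=; have [|u ual ->] := IH.
  by move=> x xsw; apply: swR; rewrite inE xsw orbT.
have [|v [val -> _]] := @reflection_simple_word a; first by rewrite swR ?mem_head.
exists (v ++ u); last by rewrite refl_prod_cat.
by move=> x; rewrite mem_cat => /orP[/val|/ual].
Qed.

Lemma weyl_word u : {subset u <= alpha} -> W (refl_prod dot u).
Proof. by move=> ual; exists u => // x /ual; have [_ + _] := simpleR; apply. Qed.

End Base.

(** * Lengths, signs and the exchange property *)

Section Length.
Context (R : realType) (V : vectType R) (dot : {dot V for (@idfun R)}).
Context (R0 : {fset V}) (rootR : root_system dot R0) (redR : reduced R0).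
Context (n : nat) (alpha : n.-tuple V) (simpleR : simple_roots alpha R0).

Local Notation s := (reflection dot).
Local Notation "x ^v" := (coroot dot x) (at level 2, format "x ^v").
Local Notation W := (weyl_group dot R0).
Local Notation al := (tnth alpha).
Local Notation pos := (pos_cone alpha).
Local Notation Rpos := (pos_roots alpha R0).
Local Notation dominant := (dominant dot alpha).

Lemma simple_word_mem (u : seq V) a : {subset u <= alpha} -> a \in u ->
  exists j, a = al j.
Proof. by move=> ual /ual/tnthP. Qed.

Lemma refl_prod_deletion u j : {subset u <= alpha} ->
  ~~ pos (refl_prod dot u (al j)) ->
  exists v, [/\ {subset v <= alpha}, (size v < size u)%N
    & refl_prod dot u = refl_prod dot v \o s (al j)].
Proof.
elim: u => [|a u IH] ual /=; first by rewrite (pos_simple simpleR).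
have [i aE] := simple_word_mem ual (mem_head _ _).
have {}ual : {subset u <= alpha} by move=> x xu; rewrite ual // inE xu orbT.
have Wu := weyl_word dot simpleR ual.
have ujR := weyl_root rootR Wu (simple_root simpleR j).
have [pu|npu _] := boolP (pos (refl_prod dot u (al j))); last first.
  have [v [val szv uE]] := IH ual npu.
  exists (a :: v); split=> //=; last by rewrite uE.
  by move=> x; rewrite inE => /predU1P[->|/val//]; rewrite aE mem_tnth.
rewrite {}aE => npsu; have ujE : refl_prod dot u (al j) = al i.
  by apply/eqP; apply: contraNT npsu; exact: (pos_root_reflection rootR).
exists u; split=> //; apply: funext => x /=.
by rewrite (weyl_reflection _ _ Wu) ujE.
Qed.

Lemma dominant_weyl_unique w x : W w -> dominant x -> dominant (w x) -> w x = x.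
Proof.
move=> /(weyl_simple_word rootR redR simpleR)[u + ->] domx.
have [m] := ubnP (size u); elim: m u => // m IH u szu ual domu.
case/lastP: u => [|u a] // in szu ual domu *.
have [j aE] : exists j, a = al j.
  by apply: simple_word_mem ual _; rewrite mem_rcons mem_head.
rewrite {}aE in szu ual domu *.
(* If the word keeps [al j] positive, its prefix makes it negative, and exchange in the prefix
   cancels the last letter. *)
have [puj|npuj] := boolP (pos (refl_prod dot (rcons u (al j)) (al j))).
  have {}ual : {subset u <= alpha}.
    by move=> y yu; rewrite ual // mem_rcons inE yu orbT.
  have [|v [val szv uE]] := @refl_prod_deletion u j ual.
    have Wu := weyl_word dot simpleR ual.
    rewrite -(pos_rootN rootR simpleR); last first.
      exact: (weyl_root rootR Wu (simple_root simpleR j)).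
    by move: puj; rewrite refl_prod_rcons /= reflection_self (weylN _ Wu).
  rewrite refl_prod_rcons uE /= reflectionK in domu *.
  by apply: IH => //; apply: leq_trans szv _; rewrite size_rcons in szu; rewrite ltnW.
have Wuj := weyl_word dot simpleR ual.
(* Now the word makes [al j] negative, so dominance of both vectors forces [x] to be orthogonal to
   [al j], hence fixed by its reflection. *)
have xj : dot x (al j) = 0.
  apply/eqP; rewrite eq_le domx andbT -(weyl_dot _ _ Wuj) -oppr_ge0 -dotNr.
  apply: (dot_dominant_pos simpleR) => //; rewrite (pos_rootN rootR simpleR) //.
  exact: (weyl_root rootR Wuj (simple_root simpleR j)).
have [v [val szv uE]] := refl_prod_deletion ual npuj.
have sx : s (al j) x = x.
  by rewrite /reflection dot_coroot xj mulr0 scale0r subr0.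
rewrite uE /= sx in domu *.
by apply: IH => //; apply: leq_trans szv _.
Qed.

Definition root_sign (a : V) : R[i] := if pos a then 1 else -1.

(** This is [-1] to the number of positive roots made negative by [w]. It refers to no word and
    flips with each simple reflection, so it gives the parity of every simple word for [w]. *)
Definition weyl_sign (w : V -> V) : R[i] := \prod_(a <- Rpos) root_sign (w a).

Lemma root_signN a : a \in R0 -> root_sign (- a) = - root_sign a.
Proof.
move=> aR; rewrite /root_sign (pos_rootN rootR simpleR aR).
by case: pos => /=; rewrite ?opprK.
Qed.

Lemma weyl_sign_simple w j : W w -> weyl_sign (w \o s (al j)) = - weyl_sign w.
Proof.
move=> Ww; have jpos := simple_mem_pos_roots simpleR j; rewrite /weyl_sign.
rewrite (bigD1_seq _ jpos) ?fset_uniq //= reflection_self (weylN _ Ww).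
rewrite root_signN ?(weyl_root rootR Ww (simple_root simpleR j)) // mulNr.
rewrite (big_pos_roots_reflection rootR redR simpleR _ (fun a => root_sign (w a))).
by rewrite -(bigD1_seq _ jpos) ?fset_uniq.
Qed.

Lemma weyl_sign_word u : {subset u <= alpha} ->
  weyl_sign (refl_prod dot u) = (-1) ^+ size u.
Proof.
elim/last_ind: u => [|u a IH] ual.
  rewrite /weyl_sign big_seq big1 // => a.
  by rewrite mem_pos_roots /root_sign /= => /andP[_ ->].
have [j ->] : exists j, a = al j.
  by apply: simple_word_mem ual _; rewrite mem_rcons mem_head.
have {}ual : {subset u <= alpha}.
  by move=> y yu; rewrite ual // mem_rcons inE yu orbT.
rewrite refl_prod_rcons (weyl_sign_simple _ (weyl_word dot simpleR ual)).
by rewrite IH // size_rcons exprS mulN1r.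
Qed.

Lemma weyl_sign_length w : W w -> (-1) ^+ weyl_length dot alpha w = weyl_sign w.
Proof.
move=> Ww; have [u0 u0al wE] := weyl_simple_word rootR redR simpleR Ww.
(* A shortest word exists, so [xget] does not fall back on its default [0]. *)
pose P k := `[<exists u, [/\ {subset u <= alpha}, w = refl_prod dot u & size u = k]>].
have exP : exists k, P k by exists (size u0); apply/asboolP; exists u0.
case: (ex_minnP exP) => k /asboolP Pk kmin.
rewrite /weyl_length; case: xgetP => [l _ [[u [ual -> <-]] _]|/(_ k) []].
  by rewrite weyl_sign_word.
split=> // v val vE; apply: kmin; apply/asboolP; exists v; split => //.
Qed.

Lemma weyl_length_reflection w a : W w -> a \in R0 ->
  (-1) ^+ weyl_length dot alpha (w \o s a) =
  - (-1) ^+ weyl_length dot alpha w :> R[i].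
Proof.
move=> Ww aR; have Ws := weyl_refl dot aR.
rewrite !weyl_sign_length //; last exact: weyl_comp.
have [u ual ->] := weyl_simple_word rootR redR simpleR Ww.
have [v [val -> ov]] := reflection_simple_word rootR redR simpleR aR.
rewrite -refl_prod_cat !weyl_sign_word //; last first.
  by move=> x; rewrite mem_cat => /orP[/ual|/val].
by rewrite size_cat exprD -[X in _ * X]signr_odd ov expr1 mulrN1.
Qed.

End Length.

(** * Irreducibility and dominant roots *)

Section Irreducible.
Context (R : realType) (V : vectType R) (dot : {dot V for (@idfun R)}).
Context (R0 : {fset V}) (rootR : root_system dot R0) (redR : reduced R0).
Context (n : nat) (alpha : n.-tuple V) (simpleR : simple_roots alpha R0).

Local Notation s := (reflection dot).
Local Notation "x ^v" := (coroot dot x) (at level 2, format "x ^v").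
Local Notation W := (weyl_group dot R0).
Local Notation al := (tnth alpha).
Local Notation pos := (pos_cone alpha).
Local Notation Rpos := (pos_roots alpha R0).
Local Notation dominant := (dominant dot alpha).

Lemma dominant_root_pos a : a \in R0 -> dominant a -> pos a.
Proof.
move=> aR doma; apply: contraTT (root_dot_gt0 rootR aR) => npa.
rewrite -leNgt -oppr_ge0 -dotNr (dot_dominant_pos simpleR) //.
by rewrite (pos_rootN rootR simpleR).
Qed.

(** Otherwise the reflection of [al i] in [al j] would be a root with coefficient [1] at [al i] and
    a negative one at [al j]. *)
Lemma simple_obtuse i j : i != j -> dot (al i) (al j) <= 0.
Proof.
move=> ij; rewrite leNgt; apply/negP => ij0.
have [_ _ posR] := simpleR.
have /posR : s (al j) (al i) \in R0 
  by apply: root_reflection => //; exact: simple_root simpleR _.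
have k0 : 0 < dot (al i) (al j)^v.
  by rewrite lt0r dot_coroot_eq0 dot_coroot_ge0 (gt_eqF ij0) ltW.
case=> [/(pos_coord_ge0 j)|/(pos_coord_ge0 i)].
  rewrite linearB linearZ /= !(coord_simple simpleR) eqxx eq_sym (negbTE ij).
  by rewrite mulr1 sub0r oppr_ge0 leNgt k0.
rewrite linearN linearB linearZ /= !(coord_simple simpleR) eqxx (negbTE ij).
by rewrite mulr0 subr0 oppr_ge0 ler10.
Qed.

Lemma dot_simple_expand x y : dot x y = \sum_i coord alpha i y * dot x (al i).
Proof.
rewrite {1}[y](coord_simpleE simpleR) dot_sumr.
by apply: eq_bigr => i _; rewrite dotZr.
Qed.

Definition supported (I : pred 'I_n) (x : V) : bool :=
  [forall i, ~~ I i ==> (coord alpha i x == 0)].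

Lemma supportedP (I : pred 'I_n) x :
  reflect (forall i, ~~ I i -> coord alpha i x = 0) (supported I x).
Proof.
apply: (iffP forallP) => Ix i; first by move=> /(implyP (Ix i))/eqP.
by apply/implyP => /Ix ->.
Qed.

Lemma supported_dot0 (I : pred 'I_n) x y :
  (forall i j, I i -> ~~ I j -> dot (al i) (al j) = 0) ->
  supported I x -> supported (predC I) y -> dot x y = 0.
Proof.
move=> orthI /supportedP Ix /supportedP Iy.
rewrite dot_simple_expand big1 // => j _; have [Ij|nIj] := boolP (I j).
  by rewrite Iy ?mul0r //= Ij.
rewrite dotC dot_simple_expand big1 ?mulr0 // => i _; have [Ii|nIi] := boolP (I i).
  by rewrite dotC orthI ?mulr0.
by rewrite Ix ?mul0r.
Qed.

Lemma supported_reflection (I : pred 'I_n) x j :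
  (forall i k, I i -> ~~ I k -> dot (al i) (al k) = 0) ->
  supported I x -> supported I (s (al j) x).
Proof.
move=> orthI Ix; have [Ij|nIj] := boolP (I j).
  apply/supportedP => i nIi; rewrite linearB linearZ /= (coord_simple simpleR).
  have /negbTE -> : i != j by apply: contraNneq nIi => ->.
  by rewrite mulr0 subr0; move/supportedP: Ix => ->.
have -> : s (al j) x = x; last by [].
rewrite /reflection dot_coroot (supported_dot0 orthI Ix) ?mulr0 ?scale0r ?subr0 //.
apply/supportedP => i /negPn Ii; rewrite (coord_simple simpleR).
by have /negbTE -> : i != j by apply: contraNneq nIj => <-.
Qed.

(** Simple roots lie in one block, and a simple reflection keeps a support within its block, since
    it acts trivially when its index lies in the other one. *)
Lemma root_supported (I : pred 'I_n) a :
  (forall i j, I i -> ~~ I j -> dot (al i) (al j) = 0) -> a \in R0 ->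
  supported I a || supported (predC I) a.
Proof.
move=> orthI; move: a; apply: (root_induction rootR redR simpleR) => [j|a j _].
  have [Ij|nIj] := boolP (I j); apply/orP; [left|right]; apply/supportedP => i nIi;
  rewrite (coord_simple simpleR); suff /negbTE -> : i != j by [].
    by apply: contraNneq nIi => ->.
  by apply: contraNneq nIi => -> /=.
case/orP => Ia; apply/orP; [left|right]; apply: supported_reflection => //.
by move=> i k /= nIi /negPn Ik; rewrite dotC orthI.
Qed.

(* If [dot a b = 0], then the simple roots in the support of [a] are orthogonal
   to the other ones and to [b]; by irreducibility they are all of them. *)
Lemma dominant_dot_gt0 a b : irreducible_roots dot R0 ->
  a \in R0 -> b \in R0 -> dominant a -> dominant b -> 0 < dot a b.
Proof.
move=> [_ irrR] aR bR doma domb; have pa := dominant_root_pos aR doma.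
rewrite lt0r (dot_dominant_pos simpleR doma) ?dominant_root_pos // andbT.
apply/eqP => ab0; pose I i := coord alpha i a != 0.
have Ib i : I i -> dot b (al i) = 0.
  move=> ai; have := dot_simple_expand b a; rewrite dotC ab0 => /esym/psumr_eq0P.
  move=> /(_ (fun k _ => mulr_ge0 (pos_coord_ge0 k pa) (domb k)) i isT)/eqP.
  by rewrite mulf_eq0 (negbTE ai) => /eqP.
(* For [j] outside the support of [a], every term of the expansion of [dot (al j) a] is nonpositive,
   while dominance makes the sum nonnegative. *)
have orthI i j : I i -> ~~ I j -> dot (al i) (al j) = 0.
  move=> Ii nIj; have le0 k : coord alpha k a * dot (al j) (al k) <= 0.
    have [->|kj] := eqVneq k j; first by rewrite (eqP (negPn nIj)) mul0r.
    by rewrite mulr_ge0_le0 ?pos_coord_ge0 // simple_obtuse // eq_sym.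
  have := doma j; rewrite dotC dot_simple_expand (bigD1 i) //= => ge0.
  have le0' : \sum_(k < n | k != i) coord alpha k a * dot (al j) (al k) <= 0.
    exact: sumr_le0.
  have /eqP : coord alpha i a * dot (al j) (al i) = 0.
    by apply/eqP; rewrite eq_le le0; lra.
  by rewrite mulf_eq0 (negbTE Ii) /= dotC => /eqP.
have [||S0|SR] := irrR [fset x in R0 | supported I x]%fset.
- by apply/fsubsetP => x; rewrite !inE => /andP[].
- move=> x y; rewrite !inE => /andP[_ Ix] /andP[+ yR]; rewrite yR /= => nIy.
  apply: (supported_dot0 orthI) => //.
  by have := root_supported orthI yR; rewrite (negbTE nIy).
- have : a \in [fset x in R0 | supported I x]%fset.
    by rewrite !inE aR; apply/supportedP => i /negPn/eqP.
  by rewrite S0 inE.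
have := root_neq0 rootR bR; suff -> : b = 0 by rewrite eqxx.
have [balpha _ _] := simpleR; apply: (@dot_full0 _ _ dot _ alpha).
  exact: span_basis.
move=> _ /tnthP[i ->]; apply: Ib.
have : al i \in R0 := simple_root simpleR i.
rewrite -SR !inE => /andP[_ /supportedP Iali]; apply: contraT => /Iali/eqP.
by rewrite (coord_simple simpleR) eqxx oner_eq0.
Qed.

(** Among the roots as long as [a] that pair with [y] at least as much as [a], take one with maximal
    [rho] pairing. A negative pairing with a simple root would let the reflection raise the [rho]
    pairing without lowering the one with [y]. *)
Lemma dominant_conjugate y a : dominant y -> a \in R0 ->
  exists b, [/\ b \in R0, dominant b, dot b b = dot a a & dot y a <= dot y b].
Proof.
move=> domy aR; pose a' := FSetSub aR.
pose P (b : R0) := (dot (val b) (val b) == dot a a) && (dot y a <= dot y (val b)).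
have Pa : P a' by rewrite /P /= eqxx lexx.
pose ht (b : R0) := dot (rho alpha R0) (val b).
case: (Order.TotalTheory.arg_maxP ht Pa) => b /andP[/eqP bb yb] bmax.
exists (val b); split=> //; first exact: valP.
move=> j; rewrite leNgt; apply/negP => bj.
have sbR : s (al j) (val b) \in R0.
  by apply: root_reflection => //; [exact: simple_root simpleR _|exact: valP].
have k0 : dot (val b) (al j)^v < 0.
  by rewrite dot_coroot pmulr_rlt0 // divr_gt0 // (simple_dot_gt0 rootR simpleR).
have := bmax (FSetSub sbR); rewrite /P /ht /= dot_reflection bb eqxx /= => H.
have : dot (rho alpha R0) (s (al j) (val b)) <= dot (rho alpha R0) (val b).
  apply: H; apply: le_trans yb _; rewrite /reflection dotDr dotNr dotZr lerDl.
  by rewrite oppr_ge0 mulr_le0_ge0 ?domy // ltW.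
rewrite /reflection dotDr dotNr dotZr gerDl oppr_le0 leNgt.
by rewrite nmulr_rlt0 // (dot_rho_simple_gt0 rootR redR simpleR).
Qed.

(** * The highest short root *)

Section HighestShortRoot.
Context (theta : V) (highest : highest_short_root dot alpha R0 theta).

Lemma highest_short_root_mem : theta \in R0.
Proof. by case: highest => [[]]. Qed.

Lemma dominant_highest_short_root : dominant theta.
Proof.
move=> j; rewrite leNgt; apply/negP => tj.
have [[tR tmin] hi] := highest.
have k0 : dot theta (al j)^v < 0.
  by rewrite dot_coroot pmulr_rlt0 // divr_gt0 // (simple_dot_gt0 rootR simpleR).
have /hi : short_roots dot R0 (s (al j) theta).
  split; last by move=> b bR; rewrite dot_reflection tmin.
  by apply: root_reflection => //; exact: simple_root simpleR _.
move=> /(pos_coord_ge0 j); rewrite /reflection opprB addrC subrK.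
by rewrite linearZ /= (coord_simple simpleR) eqxx mulr1 leNgt k0.
Qed.

(** It suffices to treat a dominant root [b] as long as [a]. In the [Dual] case this makes one
    affine inequality imply all upper bounds defining the alcove. *)
Lemma highest_short_coroot y a : irreducible_roots dot R0 -> dominant y ->
  a \in R0 -> dot y a^v <= dot y theta^v.
Proof.
move=> irrR domy aR; have [[tR tmin] _] := highest.
have [b [bR domb bb yab]] := dominant_conjugate domy aR.
have b0 := root_dot_gt0 rootR bR; have t0 := root_dot_gt0 rootR tR.
apply: (@le_trans _ _ (dot y b^v)).
  by rewrite !dot_coroot -bb ler_pM2l // divr_gt0.
have domt := dominant_highest_short_root.
have tb := dominant_dot_gt0 irrR tR bR domt domb.
have yt : 0 <= dot y theta^v.
  by rewrite dot_coroot_ge0 (dot_dominant_pos simpleR) // dominant_root_pos.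
have m_int := root_int rootR bR tR.
have [m1|m1] := leP (dot theta b^v) 1; last first.
  have m2 : 2 <= dot theta b^v.
    have : 1 <= dot theta b^v - 1.
      by apply: int_gt0_ge1; rewrite ?rpredB ?rpred1 // subr_gt0.
    lra.
  suff -> : b = theta by [].
  (* As [theta] has minimal length, a pairing of at least [2] gives
     [dot (b - theta) (b - theta) <= 0]. *)
  apply: contraTeq m2; rewrite -subr_eq0 -(dot_gt0 dot) -ltNge.
  rewrite dot_coroot mulrAC ltr_pdivrMr // !dotE (dotC _ b theta).
  by have := tmin b bR; lra.
(* [s_theta b^v = b^v - <theta, b^v> theta^v] is a negative coroot. *)
have : pos (- s theta b).
  have sR := root_reflection rootR tR bR.
  rewrite (pos_rootN rootR simpleR) //; apply/negP => ps.
  have := dot_dominant_pos simpleR domt ps.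
  by rewrite -dot_reflectionC reflection_self dotNl oppr_ge0 leNgt tb.
move=> /(dot_dominant_pos simpleR domy).
rewrite -dot_coroot_ge0 corootN coroot_reflection /reflection.
have -> : dot b^v theta^v *: theta = dot theta b^v *: theta^v.
  by rewrite dot_coroot /coroot scalerA (dotC _ _ theta) mulrC mulrA mulrAC.
rewrite dotNr dotDr dotNr (dotZr _ (dot theta b^v)) opprB subr_ge0 => /le_trans; apply.
by rewrite ler_piMl.
Qed.
End HighestShortRoot.

End Irreducible.

(** * Minuscule and quasi-minuscule weights *)

Section QuasiMinuscule.
Context (R : realType) (V : vectType R) (dot : {dot V for (@idfun R)}).
Context (R0 : {fset V}) (rootR : root_system dot R0) (redR : reduced R0).
Context (irrR : irreducible_roots dot R0).
Context (n : nat) (alpha : n.-tuple V) (simpleR : simple_roots alpha R0).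

Local Notation s := (reflection dot).
Local Notation "x ^v" := (coroot dot x) (at level 2, format "x ^v").
Local Notation W := (weyl_group dot R0).
Local Notation pos := (pos_cone alpha).

(* The roots not orthogonal to [D] span a subspace [U] stable under all
   reflections, so every root is in [U] or orthogonal to [U]; but [g] is
   orthogonal to [U]. *)
Lemma irreducible_orthogonal_cover D g : g \in R0 ->
  (forall a, a \in R0 -> dot D a = 0 \/ dot g a = 0) ->
  dot D g = 0 -> D = 0.
Proof.
move=> gR Dg Dg0; have [_ fullR _ _] := rootR.
pose T := [seq a <- R0 | dot D a != 0].
have gU u : u \in <<T>>%VS -> dot g u = 0.
  rewrite -[T]in_tupleE => /coord_span ->; rewrite dot_sumr big1 // => i _.
  rewrite dotZr; have : T`_i \in T by rewrite mem_nth.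
  rewrite mem_filter => /andP[Di /Dg[/eqP|->]]; last by rewrite mulr0.
  by rewrite (negbTE Di).
have [_ irr] := irrR; have [||S0|SR] := irr [fset a in R0 | a \in <<T>>%VS]%fset.
- by apply/fsubsetP => x; rewrite !inE => /andP[].
- move=> u b; rewrite !inE => /andP[_ uT] /andP[+ bR]; rewrite bR /= => nbT.
  have Db : dot D b = 0.
    by apply/eqP; apply: contraNT nbT => Db; rewrite memv_span // mem_filter Db.
  move: uT; rewrite -[T]in_tupleE => /coord_span ->.
  rewrite dotC dot_sumr big1 // => i _; rewrite dotZr.
  set t := _`_i; have : t \in T by rewrite mem_nth.
  rewrite mem_filter => /andP[Dt tR].
  suff -> : dot b t = 0 by rewrite mulr0.
  apply/eqP; apply: contraNT nbT => bt.
  have tT : t \in <<T>>%VS by rewrite memv_span // mem_filter Dt.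
  (* The reflection in [b] fixes [D], so it maps [t] into [T]; then [t - s b t] is a nonzero
     multiple of [b], which puts [b] in the span. *)
  have stT : s b t \in <<T>>%VS.
    rewrite memv_span // mem_filter (root_reflection rootR bR tR) andbT.
    rewrite -dot_reflectionC.
    suff -> : s b D = D by [].
    by rewrite /reflection dot_coroot Db mulr0 scale0r subr0.
  have : dot t b^v *: b \in <<T>>%VS.
    have -> : dot t b^v *: b = t - s b t by rewrite /reflection opprB addrC subrK.
    by rewrite rpredB.
  by rewrite rpredZeq dot_coroot_eq0 dotC (negbTE bt).
- apply: (@dot_full0 _ _ dot _ _ fullR) => a aR; apply/eqP; apply: contraT => Da.
  have : a \in [fset a in R0 | a \in <<T>>%VS]%fset.
    by rewrite !inE aR memv_span // mem_filter Da.
  by rewrite S0 inE.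
have := gR; rewrite -SR !inE => /andP[_ /gU/eqP].
by rewrite dot_eq0 (negbTE (root_neq0 rootR gR)).
Qed.

Lemma quasi_minuscule_root om : quasi_minuscule dot alpha R0 om ->
  om \in R0 /\ forall a, a \in R0 ->
    -2 <= dot om a^v /\ (dot om a^v = -2 -> om = - a).
Proof.
move=> [Pom bound /eqP/cardfs1P[g gE]].
have bnd a : a \in R0 -> [/\ -2 <= dot om a^v, dot om a^v <= 2,
    dot om a^v = 2 -> a = g & dot om a^v = -2 -> a = - g].
  move=> aR; have H b : b \in R0 -> pos b -> 0 <= dot om b^v <= 2 /\
      (dot om b^v = 2 -> b = g).
    move=> bR pb; have bpos : b \in pos_roots alpha R0 by rewrite mem_pos_roots bR.
    split; first exact: bound.
    move=> om2; apply/eqP; have : b \in [fset g]%fset.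
      by rewrite -gE !inE bR pb om2 eqxx.
    by rewrite inE.
  have [_ _ /(_ a aR)[pa|pNa]] := simpleR.
    have [/andP[? ?] ?] := H a aR pa; split=> // [|/eqP]; first lra.
    by rewrite gt_eqF //; lra.
  have [] := H (- a) _ pNa; first exact: (root_opp rootR).
  rewrite corootN dotNr => /andP[? ?] om2.
  split=> [||/eqP|]; [lra|lra|by rewrite lt_eqF //; lra|].
  by move=> om2'; rewrite -om2 ?opprK // om2' opprK.
have [gR om_g] : g \in R0 /\ dot om g^v = 2.
  have : g \in [fset g]%fset by rewrite inE.
  by rewrite -gE !inE => /andP[/andP[gR _] /eqP].
(* [om - g] pairs to [0] with every root not orthogonal to [g]: this comes from
   the bounds on the pairings of [om] with [s_g a] and [s_a g]. *)
suff omE : om = g.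
  split; first by rewrite omE.
  by move=> a aR; have [? _ _ om2] := bnd a aR; split=> // /om2 ->; rewrite opprK.
have Dg : dot (om - g) g = 0.
  apply/eqP; rewrite -dot_coroot_eq0 dotDl dotNl om_g.
  by rewrite dot_coroot_self ?subrr // (root_neq0 rootR).
apply/eqP; rewrite -subr_eq0; apply/eqP.
apply: (irreducible_orthogonal_cover gR) => [a aR|]; last exact: Dg.
have [->|ag] := eqVneq a g; first by left.
have [->|aNg] := eqVneq a (- g); first by left; rewrite dotNr Dg oppr0.
have [ga|ga] := eqVneq (dot g a) 0; first by right.
left; apply/eqP; rewrite -dot_coroot_eq0 dotDl dotNl.
have refl_eq x y : s x y = y -> y \in R0 -> dot y x = 0.
  rewrite /reflection => /eqP; rewrite -subr_eq0 addrC addKr oppr_eq0.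
  rewrite scaler_eq0 dot_coroot_eq0 => /orP[/eqP //|/eqP ->] _.
  by rewrite dot0r.
have k_int : dot om a^v \is a Num.int by apply: Pom.
have g_int : dot g a^v \is a Num.int by exact: (root_int rootR).
have [k_ge k_le k2 kN2] := bnd a aR.
have k_lt : dot om a^v < 2 by rewrite lt_neqAle k_le andbT; apply: contra_neqN ag => /eqP.
have k_gt : -2 < dot om a^v.
  by rewrite lt_neqAle k_ge andbT eq_sym; apply: contra_neqN aNg => /eqP.
(* Otherwise [om] would pair to [2] with the coroot of [s a g], whence [s a g = g] and [a] is
   orthogonal to [g]. *)
have k0 : dot om a^v != 0.
  apply: contraNneq ga => k0.
  have [_ _ + _] := bnd _ (root_reflection rootR aR gR).
  rewrite coroot_reflection -dot_reflectionC {1}/reflection k0 scale0r subr0.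
  by move=> /(_ om_g)/refl_eq -> //.
have g0 : dot g a^v != 0 by rewrite dot_coroot_eq0.
have [k'_ge k'_le k'2 k'N2] := bnd _ (root_reflection rootR gR aR).
have k'E : dot om (s g a)^v = dot om a^v - 2 * dot g a^v.
  by rewrite coroot_reflection -dot_reflectionC /reflection om_g dotDl dotNl dotZl.
have sgI b : s g a = b -> a = s g b by move=> <-; rewrite reflectionK.
have k'_lt : dot om (s g a)^v < 2.
  rewrite lt_neqAle k'_le andbT; apply: contra_neqN aNg => /eqP/k'2/sgI ->.
  by rewrite reflection_self.
have k'_gt : -2 < dot om (s g a)^v.
  rewrite lt_neqAle k'_ge andbT eq_sym; apply: contra_neqN ag => /eqP/k'N2/sgI ->.
  by rewrite -scaleN1r reflectionZ reflection_self scaleN1r opprK.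
(* The integers [k = dot om a^v] and [m = dot g a^v] are nonzero, and [k] and [k - 2 * m] lie
   strictly between [-2] and [2]; only [k = m = 1] and [k = m = -1] remain. *)
move: k'_lt k'_gt k_lt k_gt k0 g0; rewrite k'E.
move: k_int g_int => /intrP[k ->] /intrP[m ->].
rewrite -[2]/(2%:~R) -intrM -intrB -mulrNz !ltr_int -[0]/(0%:~R) -intrB !eqr_int.
clear; lia.
Qed.

Lemma minuscule_orbit om :
  minuscule dot alpha R0 om \/ quasi_minuscule dot alpha R0 om ->
  forall w a, W w -> a \in R0 ->
    -2 <= dot (w om) a^v /\ (dot (w om) a^v = -2 -> w om = - a).
Proof.
move=> hom w a Ww aR; have [w' [Ww' wK w'K]] := weyl_inv Ww.
have w'aR := weyl_root rootR Ww' aR.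
have -> : dot (w om) a^v = dot om (w' a)^v.
  by rewrite -(weyl_coroot _ Ww') -(weyl_dot _ _ Ww') wK.
case: hom => [[Pom bound]|/quasi_minuscule_root[_ /(_ _ w'aR)[? om2]]]; last first.
  by split=> // /om2 ->; rewrite (weylN _ Ww) w'K.
(* A minuscule weight never pairs to [-2], so the equality case is void. *)
suff k1 : -1 <= dot om (w' a)^v by split=> [|/eqP]; [lra|rewrite gt_eqF //; lra].
have [_ _ /(_ _ w'aR)[pa|pNa]] := simpleR.
  by have := bound (w' a); rewrite mem_pos_roots w'aR pa => /(_ isT)/andP[]; lra.
have := bound (- w' a); rewrite mem_pos_roots (root_opp rootR w'aR) pNa.
by rewrite corootN dotNr => /(_ isT)/andP[]; lra.
Qed.

End QuasiMinuscule.

(** * Antisymmetry and periodicity of alternants *)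

Section Alternants.
Context (R : realType) (V : vectType R) (dot : {dot V for (@idfun R)}).
Context (R0 : {fset V}) (rootR : root_system dot R0) (redR : reduced R0).
Context (n : nat) (alpha : n.-tuple V) (simpleR : simple_roots alpha R0).

Local Notation s := (reflection dot).
Local Notation "x ^v" := (coroot dot x) (at level 2, format "x ^v").
Local Notation W := (weyl_group dot R0).
Local Notation J := (alternant dot alpha R0).
Local Notation orbit := (weyl_orbit dot R0).

Lemma expiD (x y : R) : expi (x + y) = expi x * expi y.
Proof.
apply/eqP; rewrite eq_complex /= cosD sinD eqxx /=.
by rewrite addrC [sin x * _]mulrC [X in _ + X == _]mulrC; apply/eqP; ring.
Qed.

Lemma expi_2piz (x : R) : x \is a Num.int -> expi (2 * pi * x) = 1.
Proof.
have nat2pi m : expi (2 * pi * m%:R : R) = 1.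
  have -> : 2 * pi * m%:R = 0 + (pi *+ 2) *+ m :> R.
    by rewrite add0r mulr_natr -[pi *+ 2]mulr_natl.
  rewrite /expi (periodicn (@cosD2pi R)) (periodicn (@sinD2pi R)) cos0 sin0 //.
move=> /intrP[[m|m] ->]; first exact: nat2pi.
have := expiD (2 * pi * m.+1%:R) (2 * pi * (Negz m)%:~R).
rewrite nat2pi mul1r => <-.
by rewrite NegzE mulrNz -mulrDr subrr mulr0 /expi cos0 sin0.
Qed.

Lemma weyl_rightK u : W u -> forall w, W w -> exists2 w', W w' & u \o w' = w.
Proof.
move=> Wu w Ww; have [u' [Wu' uK u'K]] := weyl_inv Wu.
exists (u' \o w); first exact: weyl_comp.
by apply: funext => x /=; rewrite u'K.
Qed.

Lemma weyl_leftmul_bij u : W u -> set_bij W W (fun w => u \o w).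
Proof.
move=> Wu; have [u' [Wu' uK u'K]] := weyl_inv Wu; split.
- by move=> w Ww; exact: weyl_comp.
- move=> v w _ _ /= /(congr1 (fun f => u' \o f)) vw; apply: funext => x.
  by have := congr1 (fun f => f x) vw; rewrite /= !uK.
- by move=> w Ww; have [w' ? ?] := weyl_rightK Wu Ww; exists w'.
Qed.

(** Left multiplication by [s a] permutes the Weyl group and flips every sign, since [s a \o w] is
    [w] composed with the reflection in the preimage of [a]. *)
Lemma alternant_reflection a x xi : a \in R0 -> J (s a x) xi = - J x xi.
Proof.
move=> aR; rewrite /alternant.
rewrite [in RHS](@reindex_fsbig _ _ _ _ _ (fun w => s a \o w) W W _
  (weyl_leftmul_bij (weyl_refl dot aR))).
rewrite -[RHS]mulN1r mulr_fsumr; apply: eq_fsbigr => w; rewrite inE => Ww.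
have [w' [Ww' wK w'K]] := weyl_inv Ww.
have -> : s a \o w = w \o s (w' a).
  by apply: funext => y /=; rewrite (weyl_reflection _ _ Ww) w'K.
rewrite (weyl_length_reflection rootR redR simpleR Ww) ?(weyl_root rootR Ww') //.
rewrite /= (weyl_reflection _ _ Ww) w'K dot_reflectionC.
by rewrite mulNr mulrN mulN1r !opprK.
Qed.

Lemma alternant_translation v x xi :
  (forall w, W w -> exists2 k, k \is a Num.int & dot (w xi) v = 2 * pi * k) ->
  J (x + v) xi = J x xi.
Proof.
move=> vk; apply: eq_fsbigr => w; rewrite inE => /vk[k k_int wv].
by rewrite dotDr expiD wv expi_2piz // mulr1.
Qed.

Lemma finite_orbit x : finite_set (orbit x).
Proof. exact: finite_image (finite_weyl rootR). Qed.

Lemma orbit_sum_weyl om w xi : W w ->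
  \sum_(nu \in orbit om) expi (dot (w xi) nu) =
  \sum_(nu \in orbit om) expi (dot xi nu).
Proof.
move=> Ww; have [w' [Ww' wK w'K]] := weyl_inv Ww.
rewrite (@reindex_fsbig _ _ _ _ _ w (orbit om)) /=; last first.
  split.
  - by move=> _ [u Wu <-]; exists (w \o u) => //; exact: weyl_comp.
  - by move=> x y _ _; exact: (can_inj wK).
  - move=> _ [u Wu <-]; exists (w' (u om)); last by rewrite w'K.
    by exists (w' \o u) => //; exact: weyl_comp.
by apply: eq_fsbigr => nu _; rewrite (weyl_dot _ _ Ww).
Qed.

(** The orbit sum takes the same value at [xi] and at [w xi], so in the term of the alternant at [w]
    the exponentials multiply to those of the [x + nu]. *)
Lemma orbit_sum_alternant om x xi :
  (\sum_(nu \in orbit om) expi (dot xi nu)) * J x xi =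
  \sum_(nu \in orbit om) J (x + nu) xi.
Proof.
rewrite /alternant (exchange_fsbig _ _ (finite_orbit om) (finite_weyl rootR)).
rewrite mulr_fsumr; apply: eq_fsbigr => w; rewrite inE => Ww.
rewrite -(orbit_sum_weyl om xi Ww) mulrC mulr_fsumr.
by apply: eq_fsbigr => nu _; rewrite dotDr expiD mulrA.
Qed.

End Alternants.

(** * The alcove and the admissible pair *)

Section Alcove.
Context (R : realType) (V : vectType R) (dot : {dot V for (@idfun R)}).
Context (R0 : {fset V}) (rootR : root_system dot R0) (redR : reduced R0).
Context (irrR : irreducible_roots dot R0).
Context (n : nat) (alpha : n.-tuple V) (simpleR : simple_roots alpha R0).
Context (phi theta : V) (t : pair_kind) (c : nat).
Context (phi_highest : highest_root alpha R0 phi).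
Context (theta_highest : highest_short_root dot alpha R0 theta).

Local Notation s := (reflection dot).
Local Notation "x ^v" := (coroot dot x) (at level 2, format "x ^v").
Local Notation W := (weyl_group dot R0).
Local Notation orbit := (weyl_orbit dot R0).
Local Notation al := (tnth alpha).
Local Notation pos := (pos_cone alpha).
Local Notation dominant := (dominant dot alpha).
Local Notation grad := (affine_gradient alpha phi theta t).
Local Notation aff := (affine_root dot alpha phi theta t c).
Local Notation P_c := (alcove_weights dot alpha R0 phi t c).
Local Notation hat := (hat dot phi t).
Local Notation hat_roots := (hat_roots dot R0 phi t).
Local Notation hat_rho := (hat_rho dot alpha R0 phi t).
Local Notation rho := (rho alpha R0).
Local Notation J := (alternant dot alpha R0).
Local Notation height := (height_const dot alpha R0 phi theta t).

Lemma highest_root_pos : phi \in R0 /\ pos phi.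
Proof.
have [phiR hi] := phi_highest; split=> //.
apply/negPn; rewrite -(pos_rootN rootR simpleR) //; apply/negP => pN.
have := root_neq0 rootR phiR; rewrite [phi](coord_simpleE simpleR) big1 ?eqxx // => i _.
have := pos_coord_ge0 i (hi _ (simple_root simpleR i)).
have := pos_coord_ge0 i pN; rewrite linearN linearB /= (coord_simple simpleR) eqxx.
by rewrite oppr_ge0 subr_ge0 => i0 /le_trans/(_ i0); rewrite ler10.
Qed.

Lemma highest_short_root_pos : theta \in R0 /\ pos theta.
Proof.
have tR := highest_short_root_mem theta_highest; split=> //.
apply: (dominant_root_pos rootR simpleR) => //.
exact: (dominant_highest_short_root rootR simpleR).
Qed.

Lemma affine_gradient0 : grad ord0 = alpha0 phi theta t.
Proof. by rewrite /affine_gradient unlift_none. Qed.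

Lemma affine_gradientS i : grad (lift ord0 i) = al i.
Proof. by rewrite /affine_gradient liftK. Qed.

Lemma affine_gradient_root j : grad j \in R0.
Proof.
case: (unliftP ord0 j) => [i|] ->; first by rewrite affine_gradientS (simple_root simpleR).
rewrite affine_gradient0 /alpha0; case: t; apply: (root_opp rootR).
  by case: highest_short_root_pos.
by case: highest_root_pos.
Qed.

Lemma alpha0_neg : pos (- alpha0 phi theta t).
Proof.
rewrite /alpha0; case: t; rewrite opprK.
  by case: highest_short_root_pos.
by case: highest_root_pos.
Qed.

Lemma affine_gradient_inj : injective grad.
Proof.
have neq i : al i != alpha0 phi theta t.
  apply/negP => /eqP e; have := alpha0_neg; rewrite -e (pos_rootN rootR simpleR).
    by rewrite (pos_simple simpleR).
  exact: simple_root simpleR i.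
move=> j k; case: (unliftP ord0 j) => [i|] ->; case: (unliftP ord0 k) => [l|] ->;
  rewrite ?affine_gradient0 ?affine_gradientS //.
- move=> il; congr lift; apply/eqP; have := coord_simple simpleR i i.
  rewrite eqxx il (coord_simple simpleR); case: eqP => // _ /eqP.
  by rewrite eq_sym oner_eq0.
- by move=> /eqP; rewrite (negbTE (neq i)).
- by move=> /esym/eqP; rewrite (negbTE (neq l)).
Qed.

Lemma affine_rootD j x y : aff j (x + y) = aff j x + dot y (grad j)^v.
Proof. by rewrite /affine_root dotDl addrAC. Qed.

Lemma affine_root_at0 j : aff j 0 = if j == ord0 then c%:R else 0.
Proof. by rewrite /affine_root dot0l add0r. Qed.

(** The linear part determines the gradient; counting affine functions thus amounts to counting
    indices. *)
Lemma affine_root_inj : injective aff.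
Proof.
move=> j k jk; apply: affine_gradient_inj; apply: (@coroot_inj _ _ dot).
apply/eqP; rewrite -subr_eq0 -(dot_eq0 dot) dotDr dotNr subr_eq0; apply/eqP.
set x := _ - _; have := affine_rootD j 0 x; have := affine_rootD k 0 x.
by rewrite jk add0r => -> /addrI.
Qed.

Lemma affine_root_int j x : weight_lattice dot R0 x -> aff j x \is a Num.int.
Proof.
move=> Px; rewrite rpredD ?Px ?affine_gradient_root //.
by case: ifP => _; rewrite ?rpred0 // natr_int.
Qed.

Lemma weight_latticeD x y : weight_lattice dot R0 x -> weight_lattice dot R0 y ->
  weight_lattice dot R0 (x + y).
Proof. by move=> Px Py a aR; rewrite dotDl rpredD ?Px ?Py. Qed.

(** This treats both kinds of pair at once; the factor depends on [a] only through its length, so it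
    is constant on Weyl orbits. *)
Definition hat_scale (a : V) : R :=
  match t with Dual => 2 / dot a a | Rescaled => 2 / dot phi phi end.

Lemma hatE a : hat a = hat_scale a *: a.
Proof. by rewrite /Defs.hat /hat_scale; case: t. Qed.

Lemma hat_scale_gt0 a : a \in R0 -> 0 < hat_scale a.
Proof.
move=> aR; rewrite /hat_scale.
by case: t; rewrite divr_gt0 ?(root_dot_gt0 rootR) //; case: highest_root_pos.
Qed.

Lemma hat_scale_reflection a b : hat_scale (s a b) = hat_scale b.
Proof. by rewrite /hat_scale dot_reflection. Qed.

Lemma hat_inj : injective hat.
Proof.
have phi0 : 2 / dot phi phi != 0.
  by rewrite gt_eqF // divr_gt0 // (root_dot_gt0 rootR) //; case: highest_root_pos.
rewrite /Defs.hat; case: t; first exact: coroot_inj.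
exact: scalerI.
Qed.

Lemma dominant_affine x : (forall i, 0 <= aff (lift ord0 i) x) <-> dominant x.
Proof.
have affE i : (0 <= aff (lift ord0 i) x) = (0 <= dot x (al i)).
  by rewrite /affine_root affine_gradientS /= addr0 dot_coroot_ge0.
by split=> H i; have := H i; rewrite affE.
Qed.

(** Simple roots give all lower bounds. The hat of [- alpha0] pairs maximally with dominant vectors,
    by the choice of [theta] or [phi], so the affine inequality gives all upper bounds. *)
Lemma alcove_affine x : P_c x <-> weight_lattice dot R0 x /\ forall j, 0 <= aff j x.
Proof.
have hat_pos a : a \in R0 -> (0 <= dot x (hat a)) = (0 <= dot x a).
  by move=> aR; rewrite hatE dotZr pmulr_rge0 ?hat_scale_gt0.
have hatp a : a \in R0 -> pos a -> hat a \in hat_pos_roots dot alpha R0 phi t.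
  by move=> aR pa; rewrite in_imfset //= mem_pos_roots aR.
have aff0 : aff ord0 x = c%:R - dot x (hat (- alpha0 phi theta t)).
  rewrite /affine_root affine_gradient0 eqxx addrC; congr (_ + _).
  by rewrite /alpha0 /Defs.hat; case: t; rewrite opprK corootN dotNr.
split=> [[Px bound]|[Px aff_ge0]]; split=> //.
  have domx : dominant x.
    move=> i; have iR := simple_root simpleR i; rewrite -hat_pos //.
    by have /andP[] := bound _ (hatp _ iR (pos_simple simpleR i)).
  move=> j; case: (unliftP ord0 j) => [i|] ->; first by move: i; apply/dominant_affine.
  have := affine_gradient_root ord0; rewrite affine_gradient0 => /(root_opp rootR) oR.
  by rewrite aff0 subr_ge0; have /andP[] := bound _ (hatp _ oR alpha0_neg).
have domx : dominant x by apply/dominant_affine => i.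
move=> _ /imfsetP[a /= + ->]; rewrite mem_pos_roots => /andP[aR pa].
rewrite hat_pos // (dot_dominant_pos simpleR) //=.
have := aff_ge0 ord0; rewrite aff0 subr_ge0; apply: le_trans.
rewrite /alpha0 /Defs.hat; case: t; rewrite opprK.
  exact: (highest_short_coroot rootR redR simpleR).
rewrite !dotZr ler_pM2l; last first.
  by rewrite divr_gt0 // (root_dot_gt0 rootR) //; case: highest_root_pos.
rewrite -subr_ge0 -dotNr -dotDr (dot_dominant_pos simpleR) //.
by case: phi_highest => _; apply.
Qed.

Lemma dot_hat_rho_simple j : dot hat_rho (al j)^v = hat_scale (al j).
Proof.
rewrite /Defs.hat_rho /half_sum /hat_pos_roots big_imfset /=; last first.
  by move=> a b _ _ /hat_inj.
under eq_bigr do rewrite hatE.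
rewrite dotZl (dot_sum_pos_roots rootR redR simpleR); first by rewrite mulKf.
by move=> a; exact: hat_scale_reflection.
Qed.

Lemma dot_hat_coroot x a : dot x (hat a)^v = (hat_scale a)^-1 * dot x a^v.
Proof. by rewrite hatE corootZ dotZr. Qed.

(** These are Cartan integers of the second system: transposed in the [Dual] case, unchanged in the
    [Rescaled] one. *)
Lemma hat_cartan_int a b : a \in R0 -> b \in R0 ->
  hat_scale a * dot a (hat b)^v \is a Num.int.
Proof.
move=> aR bR; rewrite dot_hat_coroot /hat_scale; case: t.
  have a0 := root_dot_gt0 rootR aR; have b0 := root_dot_gt0 rootR bR.
  suff -> : 2 / dot a a * ((2 / dot b b)^-1 * dot a b^v) = dot b a^v.
    exact: (root_int rootR).
  by rewrite !dot_coroot mulKf ?(dotC _ a) // gt_eqF // divr_gt0.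
rewrite mulVKf ?(root_int rootR) // gt_eqF // divr_gt0 // (root_dot_gt0 rootR) //.
by case: highest_root_pos.
Qed.

Lemma hat_rho_weight : weight_lattice dot hat_roots hat_rho.
Proof.
move=> _ /imfsetP[a /= aR ->]; move: a aR.
apply: (root_induction rootR redR simpleR) => [j|a j aR IH].
  rewrite dot_hat_coroot dot_hat_rho_simple mulVf //.
  by rewrite gt_eqF // hat_scale_gt0 // (simple_root simpleR).
rewrite hatE hat_scale_reflection -reflectionZ -hatE coroot_reflection.
rewrite -dot_reflectionC {1}/reflection dotDl dotNl dot_hat_rho_simple.
rewrite (dotZl _ (hat_scale _)).
by rewrite rpredB // hat_cartan_int // (simple_root simpleR).
Qed.

(** The choice of [alpha0] matters here: a root [b] in its orbit is the coroot of [hat b], by double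
    duality in the [Dual] case and because [b] is as long as [phi] in the [Rescaled] one. *)
Lemma hat_weight_alpha0_int z w : weight_lattice dot hat_roots z -> W w ->
  dot z (w (alpha0 phi theta t)) \is a Num.int.
Proof.
move=> Pz Ww; have := affine_gradient_root ord0; rewrite affine_gradient0 => a0R.
set b := w _; have bR : b \in R0 by exact: (weyl_root rootR).
suff -> : b = (hat b)^v by apply: Pz; rewrite in_imfset.
have bb : dot b b = dot (alpha0 phi theta t) (alpha0 phi theta t).
  exact: (weyl_dot _ _ Ww).
rewrite hatE corootZ; move: bb; rewrite /hat_scale /alpha0; case: t => bb.
  by rewrite scalerA mulVf ?scale1r // gt_eqF // divr_gt0 // (root_dot_gt0 rootR).
have b0 := root_dot_gt0 rootR bR.
rewrite dotNl dotNr opprK in bb; rewrite /coroot -bb scalerA mulVf ?scale1r //.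
by rewrite gt_eqF // divr_gt0.
Qed.

(** The multiple of the gradient separating the linear reflection of [y + rho] from the reflection
    of [y] in the wall [a_j = -1], shifted by [rho]: zero for simple roots, [h + c] for [alpha0]. *)
Definition affine_shift (j : 'I_n.+1) : R :=
  1 - dot rho (grad j)^v + (if j == ord0 then c%:R else 0).

Lemma affine_shiftS i : affine_shift (lift ord0 i) = 0.
Proof.
rewrite /affine_shift affine_gradientS (dot_rho_simple rootR redR simpleR).
by rewrite subrr add0r.
Qed.

Lemma affine_shift0 : affine_shift ord0 = height + c%:R.
Proof. by rewrite /affine_shift affine_gradient0 eqxx. Qed.

Lemma height_gt0 : 0 < height.
Proof.
rewrite /height_const ltr_pwDl // -dotNr -corootN dot_coroot_ge0.
apply: (dot_dominant_pos simpleR _ alpha0_neg).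
exact: (dominant_rho rootR redR simpleR).
Qed.

(** * Alternants at spectral points *)

Section Spectrum.
Context (xi : V) (xi_spec : spectrum0 dot alpha R0 phi theta t c xi).

(** For [j = 0] the shift [h + c] cancels the denominator of [xi]; the remaining pairings with the
    orbit of [alpha0] are integers, so all phases are multiples of [2 * pi]. *)
Lemma alternant_affine_shift j x : J (x + affine_shift j *: grad j) xi = J x xi.
Proof.
case: (unliftP ord0 j) => [i|] ->; first by rewrite affine_shiftS scale0r addr0.
rewrite affine_shift0 affine_gradient0.
have [mu [Pmu _] xiE] := xi_spec.
have Pz : weight_lattice dot hat_roots (hat_rho + mu).
  by move=> a aR; rewrite dotDl rpredD ?hat_rho_weight ?Pmu.
apply: alternant_translation => w Ww; have [w' [Ww' wK w'K]] := weyl_inv Ww.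
exists (dot (hat_rho + mu) (w' (alpha0 phi theta t))).
  exact: hat_weight_alpha0_int.
rewrite -{1}(w'K (alpha0 phi theta t)) dotZr (weyl_dot _ _ Ww) -xiE dotZl mulrA.
congr (_ * _); rewrite mulrC divfK // gt_eqF //.
by have := height_gt0; have := ler0n R c; lra.
Qed.

Lemma alternant_affine_reflection j y :
  J (y + rho) xi = - J (y + rho - (aff j y + 1) *: grad j) xi.
Proof.
have refl : s (grad j) (y + rho) =
    y + rho - (aff j y + 1) *: grad j + affine_shift j *: grad j.
  have -> : aff j y + 1 = dot (y + rho) (grad j)^v + affine_shift j.
    rewrite /affine_shift /affine_root dotDl.
    by move: (dot y _) (dot rho _) (if _ then _ else _) => p q r; ring.
  by rewrite scalerDl opprD addrA subrK.
rewrite -(alternant_affine_shift j (_ - _)) -refl.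
by rewrite (alternant_reflection rootR redR simpleR _ _ (affine_gradient_root j)) opprK.
Qed.

End Spectrum.

End Alcove.

(** * Reduction of the orbit sum to the alcove *)

Section Pieri.
Context (R : realType) (V : vectType R) (dot : {dot V for (@idfun R)}).
Context (R0 : {fset V}) (rootR : root_system dot R0) (redR : reduced R0).
Context (irrR : irreducible_roots dot R0).
Context (n : nat) (alpha : n.-tuple V) (simpleR : simple_roots alpha R0).
Context (phi theta : V) (t : pair_kind) (c : nat).
Context (phi_highest : highest_root alpha R0 phi).
Context (theta_highest : highest_short_root dot alpha R0 theta).

Local Notation s := (reflection dot).
Local Notation "x ^v" := (coroot dot x) (at level 2, format "x ^v").
Local Notation W := (weyl_group dot R0).
Local Notation orbit := (weyl_orbit dot R0).
Local Notation al := (tnth alpha).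
Local Notation pos := (pos_cone alpha).
Local Notation dominant := (dominant dot alpha).
Local Notation grad := (affine_gradient alpha phi theta t).
Local Notation aff := (affine_root dot alpha phi theta t c).
Local Notation P_c := (alcove_weights dot alpha R0 phi t c).
Local Notation hat := (hat dot phi t).
Local Notation hat_roots := (hat_roots dot R0 phi t).
Local Notation hat_rho := (hat_rho dot alpha R0 phi t).
Local Notation rho := (rho alpha R0).
Local Notation J := (alternant dot alpha R0).
Local Notation height := (height_const dot alpha R0 phi theta t).

Local Notation alcove_affineP :=
  (alcove_affine rootR redR irrR simpleR t c phi_highest theta_highest).
Local Notation grad_root :=
  (affine_gradient_root rootR simpleR t phi_highest theta_highest).

Section SmallWeight.
Context (om : V) (om_weight : weight_lattice dot R0 om).
Context (om_small : forall w a, W w -> a \in R0 ->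
  -2 <= dot (w om) a^v /\ (dot (w om) a^v = -2 -> w om = - a)).
Context (xi : V) (xi_spec : spectrum0 dot alpha R0 phi theta t c xi).

Local Notation walls lam := [set j | aff j lam = 0 /\ orbit om (grad j)].

Lemma orbit_oppr a : a \in R0 -> orbit om (- a) <-> orbit om a.
Proof.
have H b : b \in R0 -> orbit om b -> orbit om (- b).
  move=> bR [w Ww wE]; exists (s b \o w); last by rewrite /= wE reflection_self.
  exact: weyl_comp (weyl_refl dot bR) Ww.
move=> aR; split=> [/H|]; last exact: H.
by rewrite opprK; apply; exact: (root_opp rootR).
Qed.

Lemma wall_count_card lam :
  wall_count dot alpha R0 phi theta t c lam om = #|` fset_set (walls lam)|.
Proof.
rewrite /wall_count fset_set_image; last exact: finite_finset.
rewrite card_imfset //.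
exact: (affine_root_inj rootR simpleR phi_highest theta_highest).
Qed.

Lemma sum_off_alcove lam : P_c lam ->
  \sum_(nu \in orbit om `&` ~` [set nu | P_c (lam + nu)]) J (lam + nu + rho) xi =
  - (wall_count dot alpha R0 phi theta t c lam om)%:R * J (lam + rho) xi.
Proof.
move=> /alcove_affineP[Plam aff_ge0].
have refl := alternant_affine_reflection
  rootR redR simpleR phi_highest theta_highest xi_spec.
rewrite -(fsbig_widen [set - grad j | j in walls lam]); first last.
- move=> nu [[[w Ww nuE] nP] nwall] /=.
  have [j aff_lt0] : exists j, aff j (lam + nu) < 0.
    apply: contrapT => /forallNP aff_ge; apply: nP; apply/alcove_affineP; split.
      by apply: weight_latticeD => //; rewrite -nuE; exact: (weyl_weight rootR).
    by move=> j; rewrite leNgt; apply/negP.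
  have Pnu : weight_lattice dot R0 nu by rewrite -nuE; exact: (weyl_weight rootR).
  have aff_int : aff j (lam + nu) \is a Num.int.
    apply: (affine_root_int rootR) => //; last exact: weight_latticeD.
  have [nu_ge nu_eq] := om_small Ww (grad_root j).
  rewrite nuE in nu_ge nu_eq.
  (* On the wall [a_j = -1] the affine reflection fixes the weight, so its alternant equals its own
     opposite. *)
  have [affN1|affN1] := eqVneq (aff j (lam + nu)) (-1).
    have := refl j (lam + nu); rewrite affN1 addNr scale0r subr0.
    by move/eqP; rewrite -addr_eq0 -mulr2n mulrn_eq0 => /eqP.
  exfalso; apply: nwall.
  (* A negative integer other than [-1] is at most [-2]; as [a_j] is nonnegative at [lam] and drops
     by at most [2], it vanishes at [lam] and drops by exactly [2]. *)
  have aff_le : aff j (lam + nu) <= -2.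
    move: aff_int aff_lt0 affN1 => /intrP[k ->].
    rewrite -[-1]/((-1)%:~R) -[2]/(2%:~R) -mulrNz -[0]/(0%:~R) ltr_int ler_int eqr_int.
    by clear; lia.
  have affE := affine_rootD dot alpha phi theta t c j lam nu.
  have := aff_ge0 j => lam_ge0.
  have lam0 : aff j lam = 0 by apply/eqP; rewrite eq_le lam_ge0 andbT; lra.
  have {nu_eq}nuj : nu = - grad j.
    by apply: nu_eq; apply/eqP; rewrite eq_le nu_ge andbT; lra.
  exists j => //; split=> //; apply/(orbit_oppr (grad_root j)).
  by rewrite -nuj -nuE; exists w.
(* Conversely, adding [- grad j] takes [a_j] from [0] to [-2], outside the alcove. *)
- move=> _ [j [lam0 orbj] <-]; split; first exact/(orbit_oppr (grad_root j)).
  move=> /alcove_affineP[_ /(_ j)].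
  rewrite affine_rootD lam0 dotNl dot_coroot_self ?(root_neq0 rootR) ?grad_root //.
  by rewrite add0r oppr_ge0 lern0.
rewrite fsbig_image; last first.
  move=> i j _ _ /oppr_inj.
  exact: (affine_gradient_inj rootR simpleR phi_highest theta_highest).
(* Where [a_j lam = 0], the affine reflection takes [lam] to [lam - grad j], so each wall
   contributes the opposite of the term of [lam]. *)
rewrite wall_count_card (eq_fsbigr (fun=> - J (lam + rho) xi)); last first.
  move=> j; rewrite inE => -[lam0 _]; rewrite (refl j lam) lam0 add0r scale1r opprK.
  by rewrite addrAC.
rewrite fsbig_finite; last exact: finite_finset.
by rewrite big_const_seq count_predT iter_addr_0 mulNrn mulNr mulr_natl.
Qed.

Lemma orbit_sum_alcove lam : P_c lam ->
  (\sum_(nu \in orbit om) expi (dot xi nu)) * J (lam + rho) xi =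
  \sum_(nu \in [set nu | orbit om nu /\ P_c (lam + nu)]) J (lam + nu + rho) xi
  - (wall_count dot alpha R0 phi theta t c lam om)%:R * J (lam + rho) xi.
Proof.
move=> Plam; rewrite (orbit_sum_alternant rootR).
rewrite (fsbigID [set nu | P_c (lam + nu)]) /=; last exact: (finite_orbit rootR).
rewrite -mulNr -(sum_off_alcove Plam).
by congr (_ + _); apply: eq_fsbigr => nu _; rewrite addrAC.
Qed.

End SmallWeight.
End Pieri.

(** * The Pieri formula for characters *)

Theorem mainTheorem4 (R : realType) (V : vectType R)
    (dot : {dot V for (@idfun R)}) (R0 : {fset V})
    (n : nat) (alpha : n.-tuple V) (phi theta : V) (t : pair_kind) (c : nat) :
  root_system dot R0 -> reduced R0 -> irreducible_roots dot R0 ->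
  simple_roots alpha R0 ->
  highest_root alpha R0 phi -> highest_short_root dot alpha R0 theta ->
  (1 < c)%N ->
  let P_c := alcove_weights dot alpha R0 phi t c in
  let N := wall_count dot alpha R0 phi theta t c in
  let chi := weyl_character dot alpha R0 in
  forall omega : V, dominant_weights dot alpha R0 omega ->
  minuscule dot alpha R0 omega \/ quasi_minuscule dot alpha R0 omega ->
  forall lam : V, P_c lam ->
  forall xi : V, spectrum0 dot alpha R0 phi theta t c xi ->
  chi omega xi * chi lam xi =
    ((N 0 omega)%:R - (N lam omega)%:R) * chi lam xi
    + \sum_(nu \in [set nu | weyl_orbit dot R0 omega nu /\ P_c (lam + nu)])
        chi (lam + nu) xi.
Proof.
move=> rootR redR irrR simpleR phi_hi theta_hi c1 P_c N chi om [om_weight om_pos].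
move=> om_min lam Plam xi xi_spec.
have small := minuscule_orbit rootR irrR simpleR om_min.
have P_cE x := alcove_affine rootR redR irrR simpleR t c phi_hi theta_hi x.
have chiE x : chi x xi =
    (weyl_denominator dot alpha R0 xi)^-1 * alternant dot alpha R0 (x + rho alpha R0) xi.
  by [].
have [delta0|delta0] := eqVneq (weyl_denominator dot alpha R0 xi) 0.
  have chi0 x : chi x xi = 0 by rewrite chiE delta0 invr0 mul0r.
  by rewrite !chi0 !mulr0 add0r fsbig1 // => nu _; rewrite chi0.
have P_c0 : P_c 0.
  apply/P_cE; split=> [a aR|j]; first by rewrite dot0l rpred0.
  by rewrite affine_root_at0; case: ifP.
have dom_om : dominant dot alpha om.
  move=> i; rewrite -dot_coroot_ge0; apply: om_pos.
  exact: (simple_mem_pos_roots simpleR).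
have alcove_dominant x : P_c x -> dominant dot alpha x.
  by move=> /P_cE[_ aff_ge0]; apply/dominant_affine => i; exact: aff_ge0.
(* Here [c > 1] enters: [a_0] equals [c] at the origin, and [om] lowers it by at most [2]. *)
have P_c_om : P_c om.
  apply/P_cE; split=> // j; rewrite -[om]add0r affine_rootD affine_root_at0.
  have jR := affine_gradient_root rootR simpleR t phi_hi theta_hi j.
  have [om_ge _] := small id _ (weyl_id dot R0) jR.
  case: (unliftP ord0 j) om_ge => [i|] -> om_ge.
    rewrite add0r affine_gradientS dot_coroot_ge0; exact: dom_om.
  have : (2%:R : R) <= c%:R by rewrite ler_nat.
  by rewrite eqxx; lra.
have pieri := orbit_sum_alcove rootR redR irrR simpleR phi_hi theta_hi
  om_weight small xi_spec.
have := pieri 0 P_c0.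
rewrite (_ : [set nu | _] = [set om]) ?fsbig_set1; last first.
  apply/seteqP; split=> nu /=; rewrite add0r.
    move=> [[w Ww <-] /alcove_dominant].
    exact: (dominant_weyl_unique rootR redR simpleR Ww dom_om).
  move=> ->; split=> //; exists id => //; exact: weyl_id.
rewrite !add0r => omE.
have := pieri lam Plam.
(* The alternant of [rho] is the nonzero Weyl denominator, so the identity at the origin can be
   solved for the orbit sum. *)
move: omE; rewrite -/(weyl_denominator dot alpha R0 xi) => omE lamE.
rewrite -[X in _ = _ + X]mulr_fsumr !chiE.
move: omE lamE; rewrite -/(N 0 om) -/(N lam om).
set m := \sum_(nu \in weyl_orbit dot R0 om) _; set S := \sum_(nu \in _) _.
move=> /eqP; rewrite eq_sym subr_eq => /eqP -> /eqP; rewrite eq_sym subr_eq => /eqP ->.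
by field.
Qed.
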